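(* Let $X: M\rightarrow \mathbb{R}^{n+1}$ be an $n$-dimensional self-shrinker (not assumed complete) whose scalar curvature $R$ is a positive constant. Then $0<R\leq n-1$ and the squared norm $S$ of the second fundamental form satisfies $S\leq 1$ on $M$.
   Context: $X: M\to\mathbb{R}^{n+1}$ is an immersed (not necessarily embedded) connected smooth hypersurface of dimension $n$, with the induced metric. With unit normal $N$ and $h_{ij}$ the components of the second fundamental form in a local orthonormal tangent frame $\{e_i\}$ (so that the normal part of $\bar\nabla_{e_j}e_i$ in $\mathbb{R}^{n+1}$ is $h_{ij}N$), the mean curvature is $H=\sum_i h_{ii}$ and $S=\sum_{i,j}h_{ij}^2$. The hypersurface is a self-shrinker if $H+\langle X,N\rangle=0$. The scalar curvature is $R=H^2-S$ (Gauss equation). *)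

(* Defs.v *)
From HB Require Import structures.
From mathcomp Require Import all_boot all_order all_algebra.
From mathcomp Require Import all_classical all_reals all_analysis.

Set Implicit Arguments.
Unset Strict Implicit.
Unset Printing Implicit Defensive.

Import Order.TTheory GRing.Theory Num.Theory.
Import numFieldNormedType.Exports.

Local Open Scope classical_set_scope.
Local Open Scope ring_scope.

Definition dot (R : realType) (m : nat) (u v : 'rV[R]_m) : R :=
  \sum_i u 0 i * v 0 i.

(* [Ck k U f] and [smooth_on U f] are only meant for an open set U. *)
Fixpoint Ck (R : realType) (n m : nat) (k : nat) (U : set 'rV[R]_n)
    (f : 'rV[R]_n -> 'rV[R]_m) : Prop :=
  match k with
  | 0 => forall x, U x -> {for x, continuous f}
  | k'.+1 => (forall x, U x -> differentiable f x) /\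
             (forall v, Ck k' U (fun x => 'D_v f x))
  end.

Definition smooth_on (R : realType) (n m : nat) (U : set 'rV[R]_n)
    (f : 'rV[R]_n -> 'rV[R]_m) : Prop := forall k, Ck k U f.

(* The values of [fwd] outside [dom], and of [bwd] outside [img], are junk. *)
Record chart (R : realType) (n : nat) (M : topologicalType) := Chart {
  dom : set M;
  fwd : M -> 'rV[R]_n;
  bwd : 'rV[R]_n -> M;
  img : set 'rV[R]_n := fwd @` dom;
  dom_open : open dom;
  img_open : open img;
  fwdK : forall p, dom p -> bwd (fwd p) = p;
  fwd_continuous : {within dom, continuous fwd};
  bwd_continuous : {within img, continuous bwd} }.

(* Any smooth atlas determines the smooth structure; it is not required to be
   maximal. *)
Record smooth_manifold (R : realType) (n : nat) := SmoothManifold {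
  carrier :> topologicalType;
  carrier_hausdorff : hausdorff_space carrier;
  carrier_second_countable : @second_countable carrier;
  atlas : set (chart R n carrier);
  atlas_cover : forall p : carrier, exists2 c, atlas c & dom c p;
  atlas_compat : forall c d, atlas c -> atlas d ->
    smooth_on (fwd c @` (dom c `&` dom d)) (fwd d \o bwd c) }.

Definition immersion (R : realType) (n m : nat) (M : smooth_manifold R n)
    (X : M -> 'rV[R]_m) : Prop :=
  forall c, atlas c ->
    smooth_on (img c) (X \o bwd c) /\
    (forall x, img c x -> forall v, 'D_v (X \o bwd c) x = 0 -> v = 0).

(* A local orthonormal tangent frame e_1, ..., e_n together with a unit normal
   field N, over an open subset of M contained in a chart domain.  Everything
   is read in that chart, where the frame is given by vector fields w_i on an
   open subset of R^n, e_i = dX(w_i). *)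
Record adapted_frame (R : realType) (n : nat) (M : smooth_manifold R n)
    (X : M -> 'rV[R]_n.+1) := AdaptedFrame {
  fchart : chart R n M;
  fdom : set 'rV[R]_n;
  fvec : 'I_n -> 'rV[R]_n -> 'rV[R]_n;
  fnormal : 'rV[R]_n -> 'rV[R]_n.+1;
  floc : 'rV[R]_n -> 'rV[R]_n.+1 := X \o bwd fchart;
  ftan : 'I_n -> 'rV[R]_n -> 'rV[R]_n.+1 :=
    fun i x => 'D_(fvec i x) floc x;
  fchart_atlas : atlas fchart;
  fdom_open : open fdom;
  fdom_img : fdom `<=` img fchart;
  fvec_smooth : forall i, smooth_on fdom (fvec i);
  fnormal_smooth : smooth_on fdom fnormal;
  ftan_orthonormal : forall x, fdom x -> forall i j,
    dot (ftan i x) (ftan j x) = (i == j)%:R;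
  fnormal_unit : forall x, fdom x -> dot (fnormal x) (fnormal x) = 1;
  fnormal_orth : forall x, fdom x -> forall v,
    dot ('D_v floc x) (fnormal x) = 0 }.

Section FrameQuantities.
Variables (R : realType) (n : nat) (M : smooth_manifold R n).
Variables (X : M -> 'rV[R]_n.+1) (e : adapted_frame X).

Definition frame_at (p : M) : Prop :=
  dom (fchart e) p /\ fdom e (fwd (fchart e) p).

Definition normal_at (p : M) : 'rV[R]_n.+1 := fnormal e (fwd (fchart e) p).

(* h_ij = < \bar\nabla_{e_j} e_i, N > *)
Definition sff (p : M) (i j : 'I_n) : R :=
  let x := fwd (fchart e) p in
  dot ('D_(fvec e j x) (ftan e i) x) (fnormal e x).

Definition mean_curvature (p : M) : R := \sum_i sff p i i.

Definition sff_normsq (p : M) : R := \sum_i \sum_j sff p i j ^+ 2.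

(* Levi-Civita connection of the induced metric: the tangential part of the
   Euclidean derivative, for tangent fields Y viewed as R^(n+1)-valued maps. *)
Definition levi_civita (u : 'rV[R]_n -> 'rV[R]_n)
    (Y : 'rV[R]_n -> 'rV[R]_n.+1) (x : 'rV[R]_n) : 'rV[R]_n.+1 :=
  \sum_k dot ('D_(u x) Y x) (ftan e k x) *: ftan e k x.

Definition lie_bracket (u w : 'rV[R]_n -> 'rV[R]_n) (x : 'rV[R]_n) :
    'rV[R]_n :=
  'D_(u x) w x - 'D_(w x) u x.

Definition riemann (u w : 'rV[R]_n -> 'rV[R]_n)
    (Y : 'rV[R]_n -> 'rV[R]_n.+1) (x : 'rV[R]_n) : 'rV[R]_n.+1 :=
  levi_civita u (levi_civita w Y) x - levi_civita w (levi_civita u Y) x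
  - levi_civita (lie_bracket u w) Y x.

(* Sum over i, j of the sectional curvatures < R(e_i, e_j) e_j, e_i >; in
   Euclidean space this is H^2 - S by the Gauss equation. *)
Definition scalar_curvature (p : M) : R :=
  let x := fwd (fchart e) p in
  \sum_i \sum_j
    dot (riemann (fvec e i) (fvec e j) (ftan e j) x) (ftan e i x).

End FrameQuantities.

(* H + <X, N> = 0.  Both terms change sign with N, and H does not depend on the
   frame, so the condition is imposed for every adapted frame. *)
Definition self_shrinker (R : realType) (n : nat) (M : smooth_manifold R n)
    (X : M -> 'rV[R]_n.+1) : Prop :=
  immersion X /\
  forall (p : M) (e : adapted_frame X), frame_at e p ->
    mean_curvature e p + dot (X p) (normal_at e p) = 0.

(* Main.v *)
(* Write h for the second fundamental form.  On a self-shrinker the Hessian of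
   H = - <X, N> and the Simons identity show that, when R = H^2 - S is constant,
     (1 - S) R = |nabla h|^2 - |nabla H|^2.
   Constancy of R also gives H nabla H = <h, nabla h>, whence
   H^2 |nabla H|^2 <= S |nabla h|^2 by Cauchy-Schwarz.  As H^2 = S + R > S, the
   right-hand side above is nonnegative, so S <= 1; and H^2 <= n S then yields
   R = H^2 - S <= (n - 1) S <= n - 1.  Everything is local and pointwise. *)
Require Import Defs.
From HB Require Import structures.
From mathcomp Require Import all_boot all_order all_algebra.
From mathcomp Require Import all_classical all_reals all_analysis.
From mathcomp Require Import ring lra.

Import Order.TTheory GRing.Theory Num.Theory.
Import numFieldNormedType.Exports.

Local Open Scope classical_set_scope.
Local Open Scope ring_scope.

Set Implicit Arguments.
Unset Strict Implicit.
Unset Printing Implicit Defensive.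

(** * Smooth functions on an open set *)

(** The Simons identity is usually derived in a moving frame, with a connection and its curvature.
    Here the n + 1 tangential parts of the ambient basis vectors replace the frame: tensors become
    arrays of functions, and only plain derivatives of their entries occur. The price is redundancy:
    the second fundamental form is extended by zero to the normal, its derivative acquires normal
    components given by the square of the form, and the fields do not commute. These corrections are
    tracked until they cancel. As only a few rules for derivations enter, the computation is done in
    an abstract commutative ring, later instantiated by the smooth functions on an open set. Scalar
    curvature is defined through the Levi-Civita connection, so R = H^2 - S has to be proved;
    flatness of the ambient space enters there as the symmetry of second derivatives. The bound on S
    concerns every adapted frame, but the bound on R needs at least one frame to exist, whence the
    Gram-Schmidt construction at the end. *)

Lemma near_zero_differentiable (R : numFieldType) (V W : normedModType R)
    (h : V -> W) (x : V) :
  {near x, h =1 cst 0} -> differentiable h x.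
Proof.
move=> h0; have hx0 : h x = 0 by exact: nbhs_singleton h0.
have Eh : h \o shift x = cst (h x) + \0 +o_ 0 id.
  apply/eqaddoP => e e0; near=> y.
  rewrite [X in `|X|](_ : _ = h (y + x) - (h x + 0)) // hx0 addr0 subr0.
  rewrite [X in `|X|](_ : _ = 0) ?normr0 ?mulr_ge0 ?(ltW e0)//; near: y.
  by move: h0; rewrite (near_shift 0); apply: filterS => z; rewrite /= subr0.
have dh : 'd h x = \0 :> (V -> W).
  by apply: diff_unique => //; exact: cst_continuous.
by apply/diff_locallyP; rewrite dh; split=> //; exact: cst_continuous.
Unshelve. all: by end_near. Qed.

Lemma near_eq_differentiable (R : numFieldType) (V W : normedModType R)
    (f g : V -> W) (x : V) :
  {near x, f =1 g} -> differentiable f x -> differentiable g x.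
Proof.
move=> fg df; have -> : g = f + (g - f) by rewrite addrC subrK.
apply: differentiableD => //; apply: near_zero_differentiable.
by apply: filterS fg => y fgy; rewrite /= -[LHS]/(g y - f y) fgy subrr.
Qed.

Definition rsqrt (R : realType) (t : R) : R := (Num.sqrt t)^-1.

(** Writing the derivative through [rsqrt] itself lets the induction of [scalar_Ck_rsqrt] close. The
    function serves to normalize vectors in Gram-Schmidt. *)
Lemma is_derive_rsqrt (R : realType) (t : R) : 0 < t ->
  is_derive t 1 (@rsqrt R) (- 2^-1 * rsqrt t ^+ 3).
Proof.
move=> t0; have s0 : Num.sqrt t != 0 by rewrite gt_eqF// sqrtr_gt0.
have ds := is_derive1_sqrt t0.
have [dr Er] : is_derive t 1 (fun y => (Num.sqrt y)^-1)
    (- Num.sqrt t ^- 2 *: (2 * Num.sqrt t)^-1).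
  by apply: DeriveDef; [exact: derivableV|rewrite deriveV// derive_val].
apply: DeriveDef => //; rewrite Er /rsqrt /GRing.scale /=.
by field.
Qed.

Section Smooth.
Variables (R : realType) (n : nat).
Local Notation V := 'rV[R]_n.
Implicit Types (U : set V) (f g : V -> R).

Lemma eq_on_near (W : Type) U (f g : V -> W) x : open U -> U x ->
  (forall y, U y -> f y = g y) -> {near x, f =1 g}.
Proof. by move=> oU Ux fg; near=> y; apply: fg; near: y; exact: open_nbhs_nbhs. 
Unshelve. all: by end_near. Qed.

Lemma eq_on_derive (W : normedModType R) U (f g : V -> W) x v : open U -> U x ->
  (forall y, U y -> f y = g y) -> 'D_v f x = 'D_v g x.
Proof. by move=> oU Ux fg; apply: near_eq_derive; exact: eq_on_near oU Ux fg. Qed.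

(** [Ck] concerns row-vector-valued maps; this is its analogue for real-valued functions, which can
    be multiplied and form a ring. *)
Fixpoint scalar_Ck (k : nat) U f : Prop :=
  match k with
  | 0 => forall x, U x -> {for x, continuous f}
  | k'.+1 => (forall x, U x -> differentiable f x) /\
             (forall v, scalar_Ck k' U (fun x => 'D_v f x))
  end.

Definition smooth U f : Prop := forall k, scalar_Ck k U f.

Lemma scalar_Ck_ext k U f g : open U -> (forall y, U y -> f y = g y) ->
  scalar_Ck k U f -> scalar_Ck k U g.
Proof.
move=> oU; elim: k f g => [|k IH] f g fg /=.
  move=> cf x Ux; have nfg := eq_on_near oU Ux fg.
  suff : g y @[y --> x] --> g x by [].
  rewrite -(fg _ Ux); exact: cvg_trans (near_eq_cvg nfg) (cf x Ux).
move=> [df cf]; split=> [x Ux|v].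
  exact: near_eq_differentiable (eq_on_near oU Ux fg) (df x Ux).
apply: IH (cf v) => x Ux; exact: eq_on_derive oU Ux fg.
Qed.

Lemma scalar_Ck_pred k U f : scalar_Ck k.+1 U f -> scalar_Ck k U f.
Proof.
elim: k f => [|k IH] f [df cf].
  by move=> x Ux; apply: differentiable_continuous; exact: df.
by split=> // v; apply: IH; exact: cf.
Qed.

Lemma scalar_Ck_sub k U U' f : U' `<=` U -> scalar_Ck k U f -> scalar_Ck k U' f.
Proof.
move=> sU; elim: k f => [|k IH] f /=; first by move=> cf x /sU; exact: cf.
by move=> [df cf]; split=> [x /sU|v]; [exact: df|exact: IH].
Qed.

Lemma scalar_Ck_cst k U (c : R) : scalar_Ck k U (fun=> c).
Proof.
elim: k c => [|k IH] c /=; first by move=> x _; exact: cst_continuous.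
split=> [x _|v]; first exact: differentiable_cst.
by under eq_fun do rewrite derive_cst.
Qed.

Lemma scalar_CkD k U f g : open U -> scalar_Ck k U f -> scalar_Ck k U g ->
  scalar_Ck k U (fun x => f x + g x).
Proof.
move=> oU; elim: k f g => [|k IH] f g /=.
  by move=> cf cg x Ux; apply: continuousD; [exact: cf|exact: cg].
move=> [df cf] [dg cg]; split=> [x Ux|v].
  by apply: differentiableD; [exact: df|exact: dg].
apply: scalar_Ck_ext (IH _ _ (cf v) (cg v)) => // x Ux.
by rewrite deriveD//; apply: diff_derivable; [exact: df|exact: dg].
Qed.

Lemma scalar_CkM k U f g : open U -> scalar_Ck k U f -> scalar_Ck k U g ->
  scalar_Ck k U (fun x => f x * g x).
Proof.
move=> oU; elim: k f g => [|k IH] f g.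
  by move=> cf cg x Ux; apply: continuousM; [exact: cf|exact: cg].
move=> cf cg; have [df df'] := cf; have [dg dg'] := cg; split=> [x Ux|v].
  by apply: differentiableM; [exact: df|exact: dg].
have := scalar_CkD oU (IH _ _ (scalar_Ck_pred cf) (dg' v))
  (IH _ _ (scalar_Ck_pred cg) (df' v)).
apply: scalar_Ck_ext => // x Ux.
by rewrite (@deriveM _ _ f g)//; apply: diff_derivable; [exact: df|exact: dg].
Qed.

Lemma derive_rsqrt (f : V -> R) x v : 0 < f x -> differentiable f x ->
  differentiable (fun y => rsqrt (f y)) x /\
  'D_v (fun y => rsqrt (f y)) x = - 2^-1 * rsqrt (f x) ^+ 3 * 'D_v f x.
Proof.
move=> f0 df; have [/derivable1_diffP dr Er] := is_derive_rsqrt f0.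
have dq := differentiable_comp df dr.
split=> //.
rewrite (deriveE _ dq) (diff_comp df dr) /= -(deriveE _ df).
rewrite -[X in 'd (@rsqrt R) (f x) X]mulr1 linearZ /= -deriveE// Er.
exact: mulrC.
Qed.

Lemma scalar_Ck_rsqrt k U f : open U -> (forall x, U x -> 0 < f x) ->
  scalar_Ck k U f -> scalar_Ck k U (fun x => rsqrt (f x)).
Proof.
move=> oU f0; elim: k => [|k IH].
  move=> cf x Ux; apply: continuous_comp (cf _ Ux) _.
  apply: differentiable_continuous; apply/derivable1_diffP.
  by case: (is_derive_rsqrt (f0 _ Ux)).
move=> cf; have [df df'] := cf; split=> [x Ux|v].
  exact: (derive_rsqrt 0 (f0 _ Ux) (df _ Ux)).1.
have cq := IH (scalar_Ck_pred cf).
have := scalar_CkM oU (scalar_CkM oU (scalar_Ck_cst k U (- 2^-1))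
  (scalar_CkM oU cq (scalar_CkM oU cq cq))) (df' v).
apply: scalar_Ck_ext => // x Ux.
by rewrite (derive_rsqrt v (f0 _ Ux) (df _ Ux)).2 !exprS expr0 mulr1.
Qed.

Lemma smooth_ext U f g : open U -> (forall y, U y -> f y = g y) ->
  smooth U f -> smooth U g.
Proof. by move=> oU fg sf k; exact: scalar_Ck_ext (sf k). Qed.

Lemma smooth_sub U U' f : U' `<=` U -> smooth U f -> smooth U' f.
Proof. by move=> sU sf k; exact: scalar_Ck_sub (sf k). Qed.

Lemma smooth_cst U (c : R) : smooth U (fun=> c).
Proof. by move=> k; exact: scalar_Ck_cst. Qed.

Lemma smoothD U f g : open U -> smooth U f -> smooth U g ->
  smooth U (fun x => f x + g x).
Proof. by move=> oU sf sg k; exact: scalar_CkD. Qed.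

Lemma smoothM U f g : open U -> smooth U f -> smooth U g ->
  smooth U (fun x => f x * g x).
Proof. by move=> oU sf sg k; exact: scalar_CkM. Qed.

Lemma smoothN U f : open U -> smooth U f -> smooth U (fun x => - f x).
Proof.
move=> oU sf; have := smoothM oU (smooth_cst U (-1)) sf.
by apply: smooth_ext => // x _; rewrite mulN1r.
Qed.

Lemma smoothB U f g : open U -> smooth U f -> smooth U g ->
  smooth U (fun x => f x - g x).
Proof. by move=> oU sf sg; apply: smoothD => //; exact: smoothN. Qed.

Lemma smooth_sum U (I : Type) (s : seq I) (P : pred I) (F : I -> V -> R) :
  open U -> (forall i, P i -> smooth U (F i)) ->
  smooth U (fun x => \sum_(i <- s | P i) F i x).
Proof.
move=> oU sF; elim: s => [|i s IH].
  by under eq_fun do rewrite big_nil; exact: smooth_cst.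
under eq_fun do rewrite big_cons; case Pi : (P i) => //.
by apply: smoothD => //; exact: sF.
Qed.

Lemma smooth_rsqrt U f : open U -> (forall x, U x -> 0 < f x) ->
  smooth U f -> smooth U (fun x => rsqrt (f x)).
Proof. by move=> oU f0 sf k; exact: scalar_Ck_rsqrt. Qed.

Lemma smooth_derive U f v : smooth U f -> smooth U (fun x => 'D_v f x).
Proof. by move=> sf k; have [_] := sf k.+1; apply. Qed.

Lemma smooth_differentiable U f x : smooth U f -> U x -> differentiable f x.
Proof. by move=> sf; have [+ _] := sf 1%N; apply. Qed.

Lemma smooth_derivable U f x v : smooth U f -> U x -> derivable f x v.
Proof. by move=> sf Ux; apply: diff_derivable; exact: smooth_differentiable Ux. Qed.

Lemma derive_linear_comb (W : normedModType R) (f : V -> W) x (I : Type)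
    (s : seq I) (c : I -> R) (v : I -> V) : differentiable f x ->
  'D_(\sum_(i <- s) c i *: v i) f x = \sum_(i <- s) c i *: 'D_(v i) f x.
Proof.
move=> df; rewrite deriveE// linear_sum; apply: eq_bigr => i _.
by rewrite linearZ deriveE.
Qed.

Lemma derive_coords (W : normedModType R) (f : V -> W) x u :
  differentiable f x ->
  'D_u f x = \sum_j u 0 j *: 'D_(delta_mx 0 j) f x.
Proof. by move=> df; rewrite {1}[u]row_sum_delta derive_linear_comb. Qed.

(** The direction varies with the point, whereas [scalar_Ck] differentiates in fixed directions; the
    coordinates of [w] reduce one to the other. *)
Lemma smooth_derive_field U f (w : V -> V) : open U ->
  (forall j, smooth U (fun x => w x 0 j)) -> smooth U f ->
  smooth U (fun x => 'D_(w x) f x).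
Proof.
move=> oU sw sf.
have : smooth U (fun x => \sum_j w x 0 j * 'D_(delta_mx 0 j) f x).
  by apply: smooth_sum => // j _; apply: smoothM => //; exact: smooth_derive.
apply: smooth_ext => // x Ux; rewrite (derive_coords (w x)) //.
exact: smooth_differentiable Ux.
Qed.

Lemma deriveD_smooth U f g x v : smooth U f -> smooth U g -> U x ->
  'D_v (fun y => f y + g y) x = 'D_v f x + 'D_v g x.
Proof.
by move=> sf sg Ux; apply: deriveD; apply: smooth_derivable Ux.
Qed.

Lemma deriveB_smooth U f g x v : smooth U f -> smooth U g -> U x ->
  'D_v (fun y => f y - g y) x = 'D_v f x - 'D_v g x.
Proof.
by move=> sf sg Ux; apply: deriveB; apply: smooth_derivable Ux.
Qed.

Lemma deriveM_smooth U f g x v : smooth U f -> smooth U g -> U x ->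
  'D_v (fun y => f y * g y) x = 'D_v f x * g x + f x * 'D_v g x.
Proof.
move=> sf sg Ux; rewrite (@deriveM _ _ f g); try exact: smooth_derivable Ux.
by rewrite /GRing.scale /= addrC mulrC.
Qed.

Lemma derive_sum_smooth U (I : Type) (s : seq I) (F : I -> V -> R) x v :
  open U -> (forall i, smooth U (F i)) -> U x ->
  'D_v (fun y => \sum_(i <- s) F i y) x = \sum_(i <- s) 'D_v (F i) x.
Proof.
move=> oU sF Ux; elim: s => [|i s IH].
  have -> : (fun y => \sum_(i <- [::]) F i y) = cst 0.
    by apply/funext => y; rewrite big_nil.
  by rewrite derive_cst big_nil.
have -> : (fun y => \sum_(j <- i :: s) F j y)
    = (fun y => F i y + \sum_(j <- s) F j y).
  by apply/funext => y; rewrite big_cons.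
by rewrite big_cons (deriveD_smooth _ (sF i) _ Ux) ?IH//; exact: smooth_sum.
Qed.

End Smooth.

(** * Symmetry of second derivatives *)

Section Schwarz.
Variables (R : realType) (n : nat).
Local Notation V := 'rV[R]_n.
Implicit Types (U : set V) (f g : V -> R).

Lemma is_derive_line f (y u : V) (s : R) : differentiable f (y + s *: u) ->
  is_derive s 1 (fun t : R => f (y + t *: u)) ('D_u f (y + s *: u)).
Proof.
move=> df; have := @diff_derivable _ _ _ f _ u df; rewrite /derivable /derive.
have -> : (fun h : R => h^-1 *: ((f \o shift (y + s *: u)) (h *: u)
      - f (y + s *: u)))
   = (fun h : R => h^-1 *: (((fun t : R => f (y + t *: u)) \o shift s) (h *: 1)
      - f (y + s *: u))).
  apply/funext => h /=; congr (_ *: (f _ - _)).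
  have -> : h *: (1 : R) = h by exact: mulr1.
  by rewrite scalerDl addrCA.
by move=> c; apply: DeriveDef.
Qed.

Lemma mvt_line f (y u : V) (h : R) : 0 < h ->
  (forall s, 0 <= s <= h -> differentiable f (y + s *: u)) ->
  exists2 s, 0 <= s <= h &
    f (y + h *: u) - f y = h * 'D_u f (y + s *: u).
Proof.
move=> h0 df.
have D s : 0 <= s <= h ->
    is_derive s 1 (fun t : R => f (y + t *: u)) ('D_u f (y + s *: u)).
  by move=> sh; apply: is_derive_line; exact: df.
have [| |c] := @MVT R (fun t => f (y + t *: u))
  (fun s => 'D_u f (y + s *: u)) 0 h h0.
- by move=> s; rewrite in_itv /= => /andP[s0 sh]; apply: D; rewrite !ltW.
- apply: derivable_within_continuous => s; rewrite in_itv /= => /D.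
  by case.
rewrite in_itv /= subr0 scale0r addr0 => /andP[c0 ch] ->.
by exists c; rewrite ?(ltW c0) ?(ltW ch)// mulrC.
Qed.

(** The mean value theorem is applied along [u] to the increment of [f] in direction [v], then along
    [v] to ['D_u f]. The second difference is symmetric in [u] and [v], which is what [schwarz]
    exploits. *)
Lemma second_difference U f (x u v : V) (h : R) : smooth U f -> 0 < h ->
  (forall s t, 0 <= s <= h -> 0 <= t <= h -> U (x + s *: u + t *: v)) ->
  exists s t, [/\ 0 <= s <= h, 0 <= t <= h &
    f (x + h *: u + h *: v) - f (x + h *: u) - (f (x + h *: v) - f x) =
    h * (h * 'D_v (fun y => 'D_u f y) (x + s *: u + t *: v))].
Proof.
move=> sf h0 hU.
have h00 : 0 <= (0 : R) <= h by rewrite lexx ltW.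
have hh : 0 <= h <= h by apply/andP; split => //; exact: ltW.
have df s t : 0 <= s <= h -> 0 <= t <= h ->
    differentiable f (x + s *: u + t *: v).
  by move=> sh th; apply: smooth_differentiable sf (hU _ _ sh th).
have df1 s : 0 <= s <= h -> differentiable (fun z => f (z + h *: v)) (x + s *: u).
  move=> sh; have d1 : differentiable (fun z : V => z + h *: v) (x + s *: u).
    by apply: differentiableD => //; exact: differentiable_cst.
  exact: (differentiable_comp d1 (df _ _ sh hh)).
have df0 s : 0 <= s <= h -> differentiable f (x + s *: u).
  by move=> sh; have := df s 0 sh h00; rewrite scale0r addr0.
have [| s sh /=] := @mvt_line (fun z => f (z + h *: v) - f z) x u h h0.
  by move=> s sh; apply: differentiableB; [exact: df1|exact: df0].
rewrite deriveB; [|exact/diff_derivable/df1|exact/diff_derivable/df0] => ->.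
have -> : 'D_u (fun z => f (z + h *: v)) (x + s *: u)
    = 'D_u f (x + s *: u + h *: v).
  rewrite /derive [X in X @ _](_ : _ = fun k => k^-1 *: ((f \o
    shift (x + s *: u + h *: v)) (k *: u) - f (x + s *: u + h *: v))) //.
  by apply/funext => k /=; rewrite -!addrA.
have [| t th ->] := @mvt_line (fun y => 'D_u f y) (x + s *: u) v h h0.
  by move=> t th; exact: (smooth_differentiable (smooth_derive u sf) (hU _ _ sh th)).
by exists s, t.
Qed.

Lemma schwarz U f x u v : open U -> smooth U f -> U x ->
  'D_v (fun y => 'D_u f y) x = 'D_u (fun y => 'D_v f y) x.
Proof.
move=> oU sf Ux; apply/eqP; rewrite -subr_eq0 -normr_le0 leNgt; apply/negP => e0.
set a := 'D_v (fun y => 'D_u f y) x in e0; set b := 'D_u _ x in e0.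
have e2 : 0 < `|a - b| / 2 by rewrite divr_gt0.
have cont w1 w2 : {for x, continuous (fun z => 'D_w2 (fun y => 'D_w1 f y) z)}.
  exact: (smooth_derive w2 (smooth_derive w1 sf) 0).
have nU : \forall z \near x, U z by exact: open_nbhs_nbhs.
have na : \forall z \near x, `|a - 'D_v (fun y => 'D_u f y) z| < `|a - b| / 2.
  by move/cvgrPdist_lt : (cont u v); apply.
have nb : \forall z \near x, `|b - 'D_u (fun y => 'D_v f y) z| < `|a - b| / 2.
  by move/cvgrPdist_lt : (cont v u); apply.
have /nbhs_ballP [d /= d0 hd] : nbhs x (U `&`
    ([set z | `|a - 'D_v (fun y => 'D_u f y) z| < `|a - b| / 2] `&`
     [set z | `|b - 'D_u (fun y => 'D_v f y) z| < `|a - b| / 2])).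
  exact: filterI nU (filterI na nb).
(* With this step the parallelogram spanned by [h *: u] and [h *: v] stays in the ball of radius
   [d]; the [+ 1] makes the bound strict and the denominator positive. *)
set h := d / (`|u| + `|v| + 1).
have q0 : 0 < `|u| + `|v| + 1 by rewrite ltr_wpDl ?addr_ge0.
have h0 : 0 < h by rewrite divr_gt0.
have hb s t : 0 <= s <= h -> 0 <= t <= h -> ball x d (x + s *: u + t *: v).
  move=> /andP[s0 sh] /andP[t0 th]; rewrite -ball_normE /= -addrA opprD addNKr normrN.
  rewrite (le_lt_trans (ler_normD _ _))// !normrZ !ger0_norm//.
  rewrite (@le_lt_trans _ _ (h * `|u| + h * `|v|))//.
    by rewrite lerD// ler_wpM2r.
  by rewrite -mulrDr /h -mulrA gtr_pMr// ltr_pdivrMl// mulr1 ltrDl.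
have hb' s t : 0 <= s <= h -> 0 <= t <= h -> ball x d (x + s *: v + t *: u).
  by move=> sh th; rewrite addrAC; exact: hb.
have [|s [t [sh th E1]]] := @second_difference U f x u v h sf h0.
  by move=> s t sh th; have [] := hd _ (hb _ _ sh th).
have [|s' [t' [sh' th' E2]]] := @second_difference U f x v u h sf h0.
  by move=> s' t' sh' th'; have [] := hd _ (hb' _ _ sh' th').
pose c := 'D_v (fun y => 'D_u f y) (x + s *: u + t *: v).
have hn : h != 0 by rewrite gt_eqF.
(* The second difference, evaluated in either order, is the square of [h] times a mixed derivative;
   the two intermediate points may differ, but both are close to [x]. *)
have E : c = 'D_u (fun y => 'D_v f y) (x + s' *: v + t' *: u).
  apply: (mulfI hn); apply: (mulfI hn); apply: etrans (esym E1) (etrans _ E2).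
  rewrite (addrAC x (h *: v)).
  have subAC (p q r s0 : R) : p - q - (r - s0) = p - r - (q - s0) by ring.
  exact: subAC.
have [_ [hac _]] := hd _ (hb _ _ sh th).
have [_ [_ hbc]] := hd _ (hb' _ _ sh' th').
have tri (p q r : R) : `|p - q| <= `|p - r| + `|q - r|.
  by rewrite (distrC q r) -[p - q](subrKA r) ler_normD.
apply/negP: (tri a b c); rewrite -ltNge.
rewrite [ltRHS]splitr; apply: ltrD; first exact: hac.
by rewrite E; exact: hbc.
Qed.

Lemma derive_field_comp U f (u : V) (w : V -> V) x : open U ->
  (forall j, smooth U (fun y => w y 0 j)) -> smooth U f -> U x ->
  'D_u (fun y => 'D_(w y) f y) x =
  \sum_j 'D_u (fun y => w y 0 j) x * 'D_(delta_mx 0 j) f x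
  + \sum_j w x 0 j * 'D_(delta_mx 0 j) (fun y => 'D_u f y) x.
Proof.
move=> oU sw sf Ux.
have E y : U y -> 'D_(w y) f y = \sum_j w y 0 j * 'D_(delta_mx 0 j) f y.
  move=> Uy; exact: derive_coords (smooth_differentiable sf Uy).
rewrite (eq_on_derive _ oU Ux E) (derive_sum_smooth _ _ oU _ Ux); last first.
  by move=> j; apply: smoothM => //; exact: smooth_derive.
rewrite -big_split; apply: eq_bigr => j _; rewrite (deriveM_smooth _ (sw j) (smooth_derive _ sf) Ux).
by rewrite (schwarz (delta_mx 0 j) u oU sf Ux).
Qed.

(* The second-order terms cancel by the symmetry of second derivatives. *)
Lemma derive_commutator U f (u w : V -> V) x : open U ->
  (forall j, smooth U (fun y => u y 0 j)) ->
  (forall j, smooth U (fun y => w y 0 j)) -> smooth U f -> U x ->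
  'D_(u x) (fun y => 'D_(w y) f y) x - 'D_(w x) (fun y => 'D_(u y) f y) x =
  'D_(\row_j ('D_(u x) (fun y => w y 0 j) x - 'D_(w x) (fun y => u y 0 j) x)) f x.
Proof.
move=> oU su sw sf Ux; have df := smooth_differentiable sf Ux.
rewrite (derive_field_comp (u x) oU sw sf Ux) (derive_field_comp (w x) oU su sf Ux).
have E : \sum_j w x 0 j * 'D_(delta_mx 0 j) (fun y => 'D_(u x) f y) x
    = \sum_j u x 0 j * 'D_(delta_mx 0 j) (fun y => 'D_(w x) f y) x.
  have dD z : differentiable (fun y => 'D_z f y) x.
    exact: (smooth_differentiable (smooth_derive z sf) Ux).
  apply: etrans (esym (derive_coords (w x) (dD (u x)))) _.
  apply: etrans _ (derive_coords (u x) (dD (w x))).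
  exact: (schwarz (u x) (w x) oU sf Ux).
have cancel (p q r s : R) : r = s -> p + r - (q + s) = p - q by move=> ->; ring.
rewrite (cancel _ _ _ _ E) (derive_coords _ df) -sumrB.
by apply: eq_bigr => j _; rewrite mxE -mulrBl.
Qed.

End Schwarz.

(** * Simons identity in a differential ring *)

(* An oriented hypersurface seen through the functions on it: [X] and [N] are the
   ambient coordinates of the position and of the unit normal, and [d a] is the
   derivative along the tangential part of the [a]-th ambient basis vector. *)
Section DifferentialRing.
Variables (A : comPzRingType) (m : nat) (d : 'I_m -> A -> A) (X N : 'I_m -> A).
Hypothesis dD : forall a f g, d a (f + g) = d a f + d a g.
Hypothesis dM : forall a f g, d a (f * g) = d a f * g + f * d a g.
Hypothesis dX : forall a b, d a (X b) = (a == b)%:R - N a * N b.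
Hypothesis unitN : \sum_a N a * N a = 1.
Hypothesis dN0 : forall f, \sum_a N a * d a f = 0.
(** A tangent vector is the sum of its derivatives of the [X c] times the tangential basis fields;
    here the vector is the bracket of the fields [a] and [b]. *)
Hypothesis d_comm : forall a b f,
  d a (d b f) - d b (d a f) = \sum_c (d a (d b (X c)) - d b (d a (X c))) * d c f.
Hypothesis double_inj : forall f : A, f + f = 0 -> f = 0.

Lemma d0 a : d a 0 = 0.
Proof. by apply: (@addrI _ (d a 0)); rewrite -dD !addr0. Qed.

Lemma dN a f : d a (- f) = - d a f.
Proof. by apply/eqP; rewrite -addr_eq0 -dD addNr d0. Qed.

Lemma dB a f g : d a (f - g) = d a f - d a g.
Proof. by rewrite dD dN. Qed.

Lemma d1 a : d a 1 = 0.
Proof. by apply: (@addrI _ (d a 1)); rewrite -{3}[1]mulr1 dM mulr1 mul1r addr0. Qed.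

Lemma d_bool a (b : bool) : d a b%:R = 0.
Proof. by case: b; rewrite ?d1 ?d0. Qed.

Lemma d_sum a (I : Type) (s : seq I) (P : pred I) (F : I -> A) :
  d a (\sum_(i <- s | P i) F i) = \sum_(i <- s | P i) d a (F i).
Proof. by rewrite (big_morph (d a) (dD a) (d0 a)). Qed.

Lemma sum_delta (a : 'I_m) (f : 'I_m -> A) : \sum_b (a == b)%:R * f b = f a.
Proof.
rewrite (bigD1 a)//= eqxx mul1r big1 ?addr0// => b /negbTE.
by rewrite eq_sym => ->; rewrite mul0r.
Qed.

(* Minus the second fundamental form, extended by zero to the normal direction;
   accordingly [trace_shape] below is minus the mean curvature. *)
Definition shape a b := d a (N b).
Local Notation h := shape.

Lemma shapeN a : \sum_b h a b * N b = 0.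
Proof.
apply: double_inj; have := congr1 (d a) unitN; rewrite d1 d_sum; apply: etrans.
by rewrite -big_split; apply: eq_bigr => b _; rewrite dM /h /=; ring.
Qed.

Let K a b c := d a (d b (X c)) - d b (d a (X c)).

Lemma bracketE a b c : K a b c = (h b a - h a b) * N c + N a * h b c - N b * h a c.
Proof. by rewrite /K !dX !dB !d_bool !dM /h; ring. Qed.

(** Applied to [X e], [d_comm] says that the bracket equals its own tangential projection, so its
    normal component times each [N e] vanishes. *)
Lemma bracketN a b : \sum_c K a b c * N c = 0.
Proof.
have E e : N e * \sum_c K a b c * N c = 0.
  have := d_comm a b (X e); rewrite -/(K a b e).
  rewrite [RHS](_ : _ = K a b e - N e * \sum_c K a b c * N c).
    move=> /(congr1 (fun z => K a b e - z)) /=.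
    by rewrite subrr opprB addrC subrK.
  rewrite -[in RHS](sum_delta e (K a b)) mulr_sumr -sumrB.
  by apply: eq_bigr => c _; rewrite -/(K a b c) dX (eq_sym c); ring.
rewrite -[LHS]mul1r -unitN mulr_suml big1// => e _.
by rewrite -mulrA E mulr0.
Qed.

(** As [h] kills the normal in its second index, [bracketE] gives [h b a - h a b] as the normal
    component of the bracket. *)
Lemma shape_sym a b : h a b = h b a.
Proof.
apply/esym/eqP; rewrite -subr_eq0; apply/eqP; rewrite -(bracketN a b).
rewrite -[LHS]mulr1 -unitN mulr_sumr.
transitivity (\sum_c (h b a - h a b) * (N c * N c)
  + (N a * \sum_c h b c * N c - N b * \sum_c h a c * N c)).
  by rewrite !shapeN; ring.
rewrite !mulr_sumr -sumrB -big_split; apply: eq_bigr => c _.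
by rewrite bracketE /=; ring.
Qed.

Lemma shapeNl b : \sum_a N a * h a b = 0.
Proof.
apply: etrans (shapeN b); apply: eq_bigr => a _.
by rewrite shape_sym mulrC.
Qed.

Lemma commutator a b f :
  d a (d b f) - d b (d a f) = \sum_c (N a * h b c - N b * h a c) * d c f.
Proof.
rewrite d_comm; apply: eq_bigr => c _; rewrite -/(K a b c) bracketE shape_sym.
by ring.
Qed.

Definition shape2 a b := \sum_c h a c * h c b.
Definition dshape c a b := d c (h a b).
Definition trace_shape := \sum_a h a a.
Definition normsq_shape := \sum_a \sum_b h a b * h a b.
Local Notation B := dshape.
Local Notation h2 := shape2.
Local Notation H := trace_shape.
Local Notation S := normsq_shape.

(** [h3] and [h4] are the traces of the third and fourth powers of [h]; both cancel in
    [simons_constant_scalar]. *)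
Let h3 := \sum_a \sum_b h2 a b * h a b.
Let h4 := \sum_a \sum_b h2 a b * h2 a b.

Lemma shape2_sym a b : h2 a b = h2 b a.
Proof.
by apply: eq_bigr => c _; rewrite mulrC (shape_sym c b) (shape_sym a c).
Qed.

Lemma shape2N a : \sum_b h2 a b * N b = 0.
Proof.
under eq_bigr do rewrite mulr_suml.
rewrite exchange_big big1 //= => c _.
under eq_bigr do rewrite -mulrA.
by rewrite -mulr_sumr shapeN mulr0.
Qed.

Lemma shape2_trace : \sum_a h2 a a = S.
Proof. by apply: eq_bigr => a _; apply: eq_bigr => b _; rewrite (shape_sym b). Qed.

Lemma dshape_sym c a b : B c a b = B c b a.
Proof. by rewrite /B shape_sym. Qed.

(** Although [h] has no normal component, its derivative has one, because [N] turns: differentiate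
    [shapeN]. *)
Lemma dshapeN c a : \sum_b B c a b * N b = - h2 c a.
Proof.
have := congr1 (d c) (shapeN a); rewrite d0 d_sum.
under eq_bigr do rewrite dM.
rewrite big_split /= => /eqP; rewrite addr_eq0 => /eqP ->.
congr (- _); apply: eq_bigr => b _; rewrite -/(h c b) mulrC.
by rewrite (shape_sym a).
Qed.

Lemma dshapeN0 a b : \sum_c N c * B c a b = 0.
Proof. exact: dN0. Qed.

(** As [h] is itself a derivative of [N], this is [commutator] on [N b]. The right-hand side
    vanishes on tangent vectors, where the classical symmetry remains. *)
Lemma codazzi c a b : B c a b - B a c b = N c * h2 a b - N a * h2 c b.
Proof.
rewrite [LHS](commutator c a (N b)) !mulr_sumr -sumrB; apply: eq_bigr => e _.
by rewrite -/(h e b); ring.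
Qed.

(** Contracted Codazzi equation; [N b * S] is the normal component forced by [dshapeN]. *)
Lemma dshape_trace b : \sum_c B c c b = d b H - N b * S.
Proof.
transitivity (\sum_c (B b c c + (N c * h2 b c - N b * h2 c c))).
  by apply: eq_bigr => c _; rewrite -codazzi dshape_sym addrC subrK.
rewrite big_split /= sumrB -mulr_sumr shape2_trace -d_sum /=.
under [X in _ + (X - _)]eq_bigr do rewrite mulrC.
by rewrite shape2N sub0r.
Qed.

Lemma shape_codazzi c :
  \sum_a \sum_b h a b * B c a b = \sum_a \sum_b h a b * B a c b + N c * h3.
Proof.
transitivity (\sum_a \sum_b (h a b * B a c b + N c * (h2 a b * h a b)
   - N a * h a b * h2 c b)).
  apply: eq_bigr => a _; apply: eq_bigr => b _.
  have -> : B c a b = B a c b + (N c * h2 a b - N a * h2 c b).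
    by rewrite -codazzi addrC subrK.
  by ring.
under eq_bigr do rewrite sumrB big_split /= -mulr_sumr.
rewrite sumrB big_split /= -mulr_sumr -[RHS]subr0; congr (_ - _).
rewrite exchange_big big1 //= => b _.
by rewrite -mulr_suml shapeNl mul0r.
Qed.

(** Of the two correction terms of [codazzi], one contracts [N] with the direction of
    differentiation and vanishes, the other contracts it with an index of the form and yields [h4]
    through [dshapeN]. *)
Lemma dshape_codazzi :
  \sum_c \sum_a \sum_b B c a b * B a c b
  = \sum_c \sum_a \sum_b B c a b * B c a b - h4.
Proof.
transitivity (\sum_c \sum_a \sum_b (B c a b * B c a b
   - (h2 a b * (N c * B c a b) - h2 c b * (B c b a * N a)))).
  apply: eq_bigr => c _; apply: eq_bigr => a _; apply: eq_bigr => b _.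
  have -> : B a c b = B c a b - (N c * h2 a b - N a * h2 c b).
    by rewrite -codazzi; ring.
  by rewrite (dshape_sym c b a); ring.
under eq_bigr do (under eq_bigr do rewrite sumrB; rewrite sumrB).
rewrite sumrB; congr (_ - _).
under eq_bigr do (under eq_bigr do rewrite sumrB; rewrite sumrB).
rewrite sumrB [X in X - _]exchange_big /= [X in X - _]big1 => [|a _]; last first.
  rewrite exchange_big big1 //= => b _.
  by rewrite -mulr_sumr dshapeN0 mulr0.
rewrite sub0r -sumrN; apply: eq_bigr => c _.
rewrite exchange_big -sumrN; apply: eq_bigr => b _.
by rewrite -mulr_sumr dshapeN; ring.
Qed.

(** * Self-shrinkers: first and second derivatives of the mean curvature *)

Hypothesis trace_shapeE : H = \sum_a X a * N a.

(** The term with [d c (X b)] drops out, a tangential projection being paired with [N]. *)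
Lemma d_trace c : d c H = \sum_b X b * h c b.
Proof.
rewrite trace_shapeE d_sum.
transitivity (\sum_b ((c == b)%:R * N b - N c * (N b * N b) + X b * h c b)).
  by apply: eq_bigr => b _; rewrite dM dX /h; ring.
by rewrite big_split /= sumrB -mulr_sumr unitN mulr1 sum_delta subrr add0r.
Qed.

(** The familiar term in [H] times the square of [h] is hidden in the last sum: it is the normal
    part of [X] paired with [B], see [dshapeN]. *)
Lemma dd_trace a b : d a (d b H) = h a b + \sum_e X e * B a b e.
Proof.
rewrite d_trace d_sum.
transitivity (\sum_e ((a == e)%:R * h b e - N a * (h b e * N e) + X e * B a b e)).
  by apply: eq_bigr => e _; rewrite dM dX /B; ring.
by rewrite big_split /= sumrB -mulr_sumr shapeN mulr0 subr0 sum_delta shape_sym.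
Qed.

(** * Self-shrinkers of constant scalar curvature *)

Variable r : A.
Hypothesis dr : forall a, d a r = 0.
Hypothesis scalarE : H * H - S = r.

Lemma trace_d_trace c : H * d c H = \sum_a \sum_b h a b * B c a b.
Proof.
apply/eqP; rewrite -subr_eq0; apply/eqP; apply: double_inj.
have := congr1 (d c) scalarE; rewrite dr dB dM; apply: etrans.
have -> : d c S = \sum_a \sum_b h a b * B c a b + \sum_a \sum_b h a b * B c a b.
  rewrite d_sum -big_split; apply: eq_bigr => a _; rewrite d_sum -big_split.
  by apply: eq_bigr => b _; rewrite dM /B /=; ring.
by ring.
Qed.

(** The drift along the tangential part of the position, which occurs in both [laplace_trace] and
    [shape_hess_trace] and cancels between them. *)
Let XH := \sum_e X e * (H * d e H).

Lemma laplace_trace : H * \sum_c d c (d c H) = H * H + XH - H * H * S.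
Proof.
transitivity (H * (H + (\sum_e X e * d e H - S * \sum_e X e * N e))).
  congr (_ * _); transitivity (\sum_c (h c c + \sum_e X e * B c c e)).
    by apply: eq_bigr => c _; rewrite dd_trace.
  rewrite big_split /=; congr (_ + _); rewrite exchange_big mulr_sumr -sumrB /=.
  by apply: eq_bigr => e _; rewrite -mulr_sumr dshape_trace; ring.
rewrite -trace_shapeE.
have -> : XH = H * \sum_e X e * d e H.
  by rewrite mulr_sumr; apply: eq_bigr => e _; ring.
by ring.
Qed.

(** Contracting [dd_trace] with [h] leaves [B] with the position in its middle index;
    [shape_codazzi] moves it to the front, where [trace_d_trace] applies. The exchange costs
    [H * h3]. *)
Lemma shape_hess_trace :
  \sum_a \sum_b h a b * d a (d b H) = S + XH - H * h3.
Proof.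
transitivity (\sum_a \sum_b (h a b * h a b + \sum_e X e * (h a b * B a e b))).
  apply: eq_bigr => a _; apply: eq_bigr => b _; rewrite dd_trace mulrDr mulr_sumr.
  by congr (_ + _); apply: eq_bigr => e _; rewrite (dshape_sym a e); ring.
under eq_bigr do rewrite big_split /= exchange_big.
rewrite big_split /= -addrA; congr (_ + _); rewrite exchange_big trace_shapeE /=.
rewrite mulr_suml -sumrB; apply: eq_bigr => e _.
under eq_bigr do rewrite -mulr_sumr.
by rewrite -mulr_sumr trace_d_trace shape_codazzi; ring.
Qed.

(** Here second derivatives of [h] are commuted, the heart of the Simons identity: [B a c b] is
    [d a (h c b)], and once [d c] has passed [d a] the divergence is given by [dshape_trace]. *)
Lemma shape_div_dshape :
  \sum_a \sum_b h a b * \sum_c d c (B a c b) = S + XH - H * h3 - S * S - h4.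
Proof.
transitivity (\sum_a \sum_b (h a b * d a (d b H) - S * (h a b * h a b)
   - d a S * (h a b * N b)
   + (\sum_e (h a b * h a e) * \sum_c N c * B e c b
      - (N a * h a b) * \sum_c \sum_e h c e * B e c b))).
  apply: eq_bigr => a _; apply: eq_bigr => b _.
  transitivity (h a b * d a (\sum_c B c c b)
    + h a b * \sum_c (d c (B a c b) - d a (B c c b))).
    by rewrite d_sum sumrB; ring.
  rewrite dshape_trace dB dM -/(h a b).
  have -> : \sum_c (d c (B a c b) - d a (B c c b))
      = \sum_e h a e * (\sum_c N c * B e c b)
        - N a * \sum_c \sum_e h c e * B e c b.
    transitivity (\sum_c (\sum_e h a e * (N c * B e c b)
                          - N a * \sum_e h c e * B e c b)).
      apply: eq_bigr => c _; rewrite [LHS](commutator c a (h c b)).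
      by rewrite mulr_sumr -sumrB; apply: eq_bigr => e _; rewrite /B; ring.
    rewrite sumrB -mulr_sumr; congr (_ - _); rewrite exchange_big /=.
    by apply: eq_bigr => e _; rewrite mulr_sumr.
  have -> : \sum_e (h a b * h a e) * (\sum_c N c * B e c b)
     = h a b * \sum_e h a e * (\sum_c N c * B e c b).
    by rewrite mulr_sumr; apply: eq_bigr => e _; rewrite mulrA.
  by ring.
(* The last two sums vanish because [h] annihilates the normal on either side. *)
transitivity (\sum_a \sum_b h a b * d a (d b H) - S * S
   - \sum_a \sum_b h2 a b * h2 a b - \sum_a d a S * (\sum_b h a b * N b)
   - \sum_b (\sum_a N a * h a b) * \sum_c \sum_e h c e * B e c b); last first.
  rewrite shape_hess_trace.
  rewrite [X in _ - X - _]big1 => [|a _]; last by rewrite shapeN mulr0.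
  rewrite [X in _ - X]big1 => [|b _]; last by rewrite shapeNl mul0r.
  by rewrite /h4; ring.
under eq_bigr do rewrite big_split /= sumrB sumrB -!mulr_sumr sumrB.
rewrite big_split /= sumrB sumrB -mulr_sumr sumrB.
have -> : \sum_b (\sum_a N a * h a b) * (\sum_c \sum_e h c e * B e c b)
   = \sum_a \sum_b (N a * h a b) * (\sum_c \sum_e h c e * B e c b).
  by rewrite exchange_big; apply: eq_bigr => b _; rewrite mulr_suml.
have -> : \sum_a \sum_b \sum_e (h a b * h a e) * (\sum_c N c * B e c b)
    = - \sum_a \sum_b h2 a b * h2 a b.
  rewrite exchange_big -sumrN; apply: eq_bigr => b _.
  rewrite exchange_big -sumrN; apply: eq_bigr => e _.
  rewrite -mulr_suml.
  have -> : \sum_c N c * B e c b = - h2 e b.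
    rewrite -dshapeN; apply: eq_bigr => c _.
    by rewrite (dshape_sym e b) mulrC.
  have -> : \sum_a h a b * h a e = h2 b e.
    by apply: eq_bigr => a _; rewrite (shape_sym b).
  by rewrite (shape2_sym e); ring.
by rewrite -/S; ring.
Qed.

(* The tangential part of [dshape], that is, minus the covariant derivative of
   the second fundamental form. *)
Definition codazzi_tensor c a b := B c a b + N b * h2 c a + N a * h2 c b.
Local Notation T := codazzi_tensor.

(** The corrections in [T] carry a factor [N], which [h] annihilates, so [T] can replace [B] in
    [trace_d_trace]. *)
Lemma shape_codazzi_tensor c : \sum_a \sum_b h a b * T c a b = H * d c H.
Proof.
rewrite trace_d_trace.
transitivity (\sum_a \sum_b (h a b * B c a b + h2 c a * (h a b * N b)
   + h2 c b * (N a * h a b))).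
  by apply: eq_bigr => a _; apply: eq_bigr => b _; rewrite /T; ring.
under eq_bigr do rewrite !big_split /= -mulr_sumr shapeN mulr0 addr0.
rewrite big_split /= [X in _ + X]exchange_big [X in _ + X]big1 ?addr0//= => b _.
by rewrite -mulr_sumr shapeNl mulr0.
Qed.

(** Removing the normal component of [B] in each of its last two slots lowers the squared norm by
    [h4] once per slot. *)
Lemma codazzi_tensor_normsq : \sum_c \sum_a \sum_b T c a b * T c a b
  = \sum_c \sum_a \sum_b B c a b * B c a b - h4 - h4.
Proof.
rewrite -!sumrB; apply: eq_bigr => c _.
transitivity (\sum_a \sum_b (B c a b * B c a b + (h2 c a * h2 c a) * (N b * N b)
  + (N a * N a) * (h2 c b * h2 c b)
  + (1 + 1) * (h2 c a * (B c a b * N b)) + (1 + 1) * (h2 c b * (B c b a * N a))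
  + (1 + 1) * ((h2 c a * N a) * (h2 c b * N b)))).
  apply: eq_bigr => a _; apply: eq_bigr => b _.
  by rewrite /T (dshape_sym c b a); ring.
under eq_bigr do rewrite !big_split /= -!mulr_sumr unitN mulr1 dshapeN
  shape2N !mulr0 addr0.
rewrite !big_split /= -mulr_suml unitN mul1r -mulr_sumr.
have -> : \sum_a (1 + 1) * \sum_b (h2 c b * (B c b a * N a))
    = (1 + 1) * \sum_b h2 c b * - h2 c b.
  rewrite -mulr_sumr exchange_big; congr (_ * _); apply: eq_bigr => b _ /=.
  by rewrite -mulr_sumr dshapeN.
under [X in (1 + 1) * X]eq_bigr do rewrite mulrN.
by rewrite sumrN; ring.
Qed.

(* Half the gradient of [H ^ 2 - S = r] is [H dH - <h, dh> = 0]; this is its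
   divergence, after exchanging indices in [dh] by the Codazzi equation. *)
Lemma simons_constant_scalar :
  r * (1 - S) + \sum_c d c H * d c H = \sum_c \sum_a \sum_b T c a b * T c a b.
Proof.
have div1 : \sum_c d c (H * d c H)
    = \sum_c d c H * d c H + H * \sum_c d c (d c H).
  by rewrite mulr_sumr -big_split; apply: eq_bigr => c _; rewrite dM.
have div2 : \sum_c d c (N c * h3) = H * h3.
  transitivity (\sum_c (h c c * h3 + N c * d c h3)).
    by apply: eq_bigr => c _; rewrite dM.
  by rewrite big_split /= -mulr_suml dN0 addr0.
have div3 : \sum_c d c (\sum_a \sum_b h a b * B a c b)
    = \sum_c \sum_a \sum_b B c a b * B a c b
      + \sum_a \sum_b h a b * \sum_c d c (B a c b).
  have -> : \sum_a \sum_b h a b * \sum_c d c (B a c b)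
      = \sum_c \sum_a \sum_b h a b * d c (B a c b).
    rewrite [RHS]exchange_big; apply: eq_bigr => a _ /=.
    by rewrite [RHS]exchange_big; apply: eq_bigr => b _ /=; rewrite mulr_sumr.
  rewrite -big_split; apply: eq_bigr => c _.
  rewrite d_sum -big_split; apply: eq_bigr => a _.
  rewrite d_sum -big_split; apply: eq_bigr => b _.
  by rewrite dM.
have E : \sum_c d c (H * d c H)
    = \sum_c d c (\sum_a \sum_b h a b * B a c b) + \sum_c d c (N c * h3).
  rewrite -big_split; apply: eq_bigr => c _ /=.
  by rewrite trace_d_trace shape_codazzi dD.
move: E; rewrite div1 div2 div3 laplace_trace dshape_codazzi shape_div_dshape.
rewrite codazzi_tensor_normsq -scalarE.
set P := \sum_c d c H * d c H; set Q := \sum_c \sum_a \sum_b _ => E.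
(* Adding and subtracting [H] times its Laplacian makes the left-hand side of [E] appear. *)
have -> : P = P + (H * H + XH - H * H * S) - (H * H + XH - H * H * S) by ring.
by rewrite E; ring.
Qed.

End DifferentialRing.

(** * The ring of smooth functions *)

Section SmoothRing.
Variables (R : realType) (n : nat) (U : set 'rV[R]_n) (oU : open U).
Local Notation V := 'rV[R]_n.

(* The smooth functions are taken on the subtype of [U], so that equality in
   their ring is equality on [U]. *)
Definition extend (f : {x : V | U x} -> R) (x : V) : R :=
  if pselect (U x) is left Ux then f (exist _ x Ux) else 0.

Lemma extendE f x (Ux : U x) : extend f x = f (exist _ x Ux).
Proof. by rewrite /extend; case: pselect => // Ux'; rewrite (Prop_irrelevance Ux' Ux). Qed.

(* The openness proof is an argument only to let the ring structure depend on
   it. *)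
Definition is_smooth (_ : open U) : {pred ({x : V | U x} -> R)} :=
  fun f => `[< smooth U (extend f) >].

Lemma is_smooth_subring : subring_closed (is_smooth oU).
Proof.
split=> [|f g /asboolP sf /asboolP sg|f g /asboolP sf /asboolP sg]; apply/asboolP.
- apply: smooth_ext (smooth_cst U 1) => // x Ux; by rewrite (extendE _ Ux).
- apply: smooth_ext (smoothB oU sf sg) => // x Ux; by rewrite !(extendE _ Ux).
- apply: smooth_ext (smoothM oU sf sg) => // x Ux; by rewrite !(extendE _ Ux).
Qed.

Record smooth_fun := SmoothFun {
  smooth_val :> {x : V | U x} -> R; _ : smooth_val \in is_smooth oU }.

HB.instance Definition _ := [isSub for smooth_val].
HB.instance Definition _ := [Choice of smooth_fun by <:].
HB.instance Definition _ :=
  GRing.SubChoice_isSubComPzRing.Build _ _ smooth_fun is_smooth_subring.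

Definition value (f : smooth_fun) : V -> R := extend f.

Lemma value_smooth f : smooth U (value f).
Proof. by case: f => f sf; apply/asboolP; exact: sf. Qed.

Lemma value_inj f g : (forall x, U x -> value f x = value g x) -> f = g.
Proof.
move=> fg; apply/val_inj/funext => -[x Ux].
by have := fg x Ux; rewrite /value !(extendE _ Ux).
Qed.

Lemma valueD f g x : U x -> value (f + g) x = value f x + value g x.
Proof. by move=> Ux; rewrite /value !(extendE _ Ux). Qed.

Lemma valueN f x : U x -> value (- f) x = - value f x.
Proof. by move=> Ux; rewrite /value !(extendE _ Ux). Qed.

Lemma valueM f g x : U x -> value (f * g) x = value f x * value g x.
Proof. by move=> Ux; rewrite /value !(extendE _ Ux). Qed.

Lemma value0 x : U x -> value 0 x = 0.
Proof. by move=> Ux; rewrite /value !(extendE _ Ux). Qed.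

Lemma value1 x : U x -> value 1 x = 1.
Proof. by move=> Ux; rewrite /value !(extendE _ Ux). Qed.

Lemma value_bool (b : bool) x : U x -> value b%:R x = b%:R.
Proof. by case: b => Ux; rewrite ?value1 ?value0. Qed.

Lemma value_sum (I : Type) (s : seq I) (P : pred I) (F : I -> smooth_fun) x :
  U x -> value (\sum_(i <- s | P i) F i) x = \sum_(i <- s | P i) value (F i) x.
Proof.
move=> Ux; apply: (big_morph (value^~ x)) => [f g|]; first exact: valueD.
exact: value0.
Qed.

Fact restrict_key (f : V -> R) (sf : smooth U f) :
  (fun p : {x : V | U x} => f (sval p)) \in is_smooth oU.
Proof.
by apply/asboolP; apply: smooth_ext sf => // x Ux; rewrite (extendE _ Ux).
Qed.

Definition restrict (f : V -> R) (sf : smooth U f) : smooth_fun :=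
  SmoothFun (restrict_key sf).

Lemma restrictE f (sf : smooth U f) x : U x -> value (restrict sf) x = f x.
Proof. by move=> Ux; rewrite /value (extendE _ Ux). Qed.

Section Derivation.
Variables (w : V -> V) (sw : forall j, smooth U (fun x => w x 0 j)).

Definition derivation (f : smooth_fun) : smooth_fun :=
  restrict (smooth_derive_field oU sw (value_smooth f)).

Lemma derivationE f x : U x -> value (derivation f) x = 'D_(w x) (value f) x.
Proof. exact: restrictE. Qed.

Lemma derivationD f g : derivation (f + g) = derivation f + derivation g.
Proof.
apply: value_inj => x Ux; rewrite valueD// !derivationE//.
rewrite -(deriveD_smooth _ (value_smooth f) (value_smooth g) Ux).
by apply: eq_on_derive oU Ux _ => y Uy; exact: valueD.
Qed.

Lemma derivationM f g : derivation (f * g) = derivation f * g + f * derivation g.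
Proof.
apply: value_inj => x Ux; rewrite valueD// !valueM// !derivationE//.
rewrite -(deriveM_smooth _ (value_smooth f) (value_smooth g) Ux).
by apply: eq_on_derive oU Ux _ => y Uy; exact: valueM.
Qed.

End Derivation.

End SmoothRing.

(** * Vector-valued functions *)

Section VectorSmooth.
Variables (R : realType) (n m : nat).
Local Notation V := 'rV[R]_n.
Local Notation W := 'rV[R]_m.
Implicit Types (U : set V) (f : V -> W).

Lemma derive_coord f x v j : differentiable f x ->
  'D_v (fun y => f y 0 j) x = 'D_v f x 0 j.
Proof.
by move=> df; rewrite (derive_mx (@diff_derivable _ _ _ f x v df)) mxE.
Qed.

Lemma differentiable_coords f x :
  (forall j, differentiable (fun y => f y 0 j : R) x) -> differentiable f x.
Proof.
move=> df; have -> : f = \sum_(j < m) (fun y => f y 0 j *: (delta_mx 0 j : W)).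
  apply/funext => y; rewrite fct_sumE; exact: row_sum_delta.
by apply: differentiable_sum => j; exact: differentiableZl.
Qed.

Lemma Ck_coord k U f j : open U -> Ck k U f ->
  scalar_Ck k U (fun x => f x 0 j).
Proof.
move=> oU; elim: k f => [|k IH] f /=.
  move=> cf x Ux.
  apply: (@continuous_comp _ _ _ f (fun M : W => M 0 j)); first exact: cf.
  exact: coord_continuous.
move=> [df cf]; split=> [x Ux|v].
  exact: (differentiable_comp (df x Ux) (differentiable_coord (f x) 0 j)).
apply: scalar_Ck_ext (IH _ (cf v)) => // x Ux.
by rewrite derive_coord//; exact: df.
Qed.

Lemma smooth_on_coord U f j : open U -> smooth_on U f ->
  smooth U (fun x => f x 0 j).
Proof. by move=> oU sf k; exact: Ck_coord (sf k). Qed.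

Lemma smooth_on_differentiable U f x : smooth_on U f -> U x ->
  differentiable f x.
Proof. by move=> sf; have [+ _] := sf 1%N; apply. Qed.

Lemma smooth_on_coords U f : open U ->
  (forall j, smooth U (fun x => f x 0 j)) -> smooth_on U f.
Proof.
move=> oU sf k; elim: k f sf => [|k IH] f sf.
  move=> x Ux; apply: differentiable_continuous; apply: differentiable_coords.
  by move=> j; exact: (smooth_differentiable (sf j) Ux).
have df x : U x -> differentiable f x.
  by move=> Ux; apply: differentiable_coords => j; exact: (smooth_differentiable (sf j) Ux).
split=> // v; apply: IH => j.
apply: smooth_ext (smooth_derive v (sf j)) => // x Ux.
by rewrite derive_coord//; exact: df.
Qed.

Lemma smooth_on_sub U U' f : U' `<=` U -> smooth_on U f -> smooth_on U' f.
Proof.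
move=> sU sf k; have := sf k; elim: k f {sf} => [|k IH] f /=.
  by move=> cf x /sU; exact: cf.
by move=> [df cf]; split=> [x /sU|v]; [exact: df|exact: IH].
Qed.

End VectorSmooth.

(** * The Euclidean inner product *)

Section Dot.
Variables (R : realType) (m : nat).
Implicit Types u v : 'rV[R]_m.

Lemma dotC u v : dot u v = dot v u.
Proof. by apply: eq_bigr => i _; rewrite mulrC. Qed.

Lemma dotDl u1 u2 v : dot (u1 + u2) v = dot u1 v + dot u2 v.
Proof. by rewrite -big_split; apply: eq_bigr => i _; rewrite mxE mulrDl. Qed.

Lemma dotZl (c : R) u v : dot (c *: u) v = c * dot u v.
Proof. by rewrite mulr_sumr; apply: eq_bigr => i _; rewrite mxE mulrA. Qed.

Lemma dotBl u1 u2 v : dot (u1 - u2) v = dot u1 v - dot u2 v.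
Proof. by rewrite dotDl -scaleN1r dotZl mulN1r. Qed.

Lemma dotZr (c : R) u v : dot u (c *: v) = c * dot u v.
Proof. by rewrite dotC dotZl dotC. Qed.

Lemma dot_suml (I : Type) (s : seq I) (F : I -> 'rV[R]_m) v :
  dot (\sum_(i <- s) F i) v = \sum_(i <- s) dot (F i) v.
Proof.
elim: s => [|i s IH]; last by rewrite !big_cons dotDl IH.
by rewrite !big_nil /dot big1// => i _; rewrite mxE mul0r.
Qed.

Lemma dot0l v : dot 0 v = 0.
Proof. by rewrite -(scale0r 0) dotZl mul0r. Qed.

Lemma dot_ge0 u : 0 <= dot u u.
Proof. by apply: sumr_ge0 => i _; rewrite -expr2 sqr_ge0. Qed.

Lemma dot_eq0 u : dot u u = 0 -> u = 0.
Proof.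
move=> /eqP; rewrite psumr_eq0 => [/allP u0|i _]; last by rewrite -expr2 sqr_ge0.
apply/rowP => i; rewrite mxE; apply/eqP.
by have := u0 i (mem_index_enum i); rewrite /= mulf_eq0 orbb.
Qed.

End Dot.

(** The matrix with rows [N] and [t i] has orthonormal rows, hence, being square, orthonormal
    columns. *)
Lemma orthonormal_complete (R : realType) (n : nat) (t : 'I_n -> 'rV[R]_n.+1)
    (N : 'rV[R]_n.+1) :
  (forall i j, dot (t i) (t j) = (i == j)%:R) -> dot N N = 1 ->
  (forall i, dot (t i) N = 0) ->
  forall a b, \sum_i t i 0 a * t i 0 b = (a == b)%:R - N 0 a * N 0 b.
Proof.
move=> tt NN tN a b.
pose Q : 'M[R]_n.+1 := \matrix_(k, c) (if unlift ord0 k is Some i then t i else N) 0 c.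
have QQ : Q *m Q^T = 1%:M.
  apply/matrixP => k l; rewrite !mxE.
  under eq_bigr do rewrite !mxE.
  case: (unliftP ord0 k) => [i|] ->; case: (unliftP ord0 l) => [j|] ->.
  - by rewrite (inj_eq lift_inj); exact: tt.
  - by rewrite eq_sym (negbTE (neq_lift _ _)); exact: tN.
  - by rewrite (negbTE (neq_lift _ _)); apply: etrans (tN j); exact: dotC.
  - by rewrite eqxx; exact: NN.
have := mulmx1C QQ => /matrixP /(_ a b); rewrite !mxE => <-.
rewrite big_ord_recl !mxE unlift_none addrAC subrr add0r.
by apply: eq_bigr => i _; rewrite !mxE liftK.
Qed.

(** * Hypersurfaces *)

(** Lagrange identity: twice the defect is the sum of the squared 2 x 2 minors. *)
Lemma cauchy_schwarz (R : realFieldType) (I : finType) (f g : I -> R) :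
  (\sum_i f i * g i) ^+ 2 <= (\sum_i f i * f i) * (\sum_i g i * g i).
Proof.
rewrite -subr_ge0 -(@pmulr_rge0 _ 2)//.
suff -> : 2 * ((\sum_i f i * f i) * (\sum_i g i * g i) - (\sum_i f i * g i) ^+ 2)
    = \sum_i \sum_j (f i * g j - f j * g i) ^+ 2.
  by apply: sumr_ge0 => i _; apply: sumr_ge0 => j _; exact: sqr_ge0.
transitivity (\sum_i \sum_j ((f i * f i) * (g j * g j) + (g i * g i) * (f j * f j)
   - 2 * ((f i * g i) * (f j * g j)))); last first.
  by apply: eq_bigr => i _; apply: eq_bigr => j _; ring.
under [RHS]eq_bigr do rewrite sumrB big_split /= -!mulr_sumr.
rewrite [RHS]sumrB big_split /= -mulr_sumr -!mulr_suml.
by ring.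
Qed.

(** The comparison is made after multiplication by [H * H], which equals [S + r] and is positive, so
    nothing is divided by [H]. *)
Lemma shape_bound (R : realFieldType) (m : nat) (S r H : R) (g : 'I_m -> R)
    (h : 'I_m -> 'I_m -> R) (T : 'I_m -> 'I_m -> 'I_m -> R) : 0 < r ->
  H * H - S = r -> S = \sum_a \sum_b h a b * h a b ->
  (forall c, H * g c = \sum_a \sum_b h a b * T c a b) ->
  r * (1 - S) + \sum_c g c * g c = \sum_c \sum_a \sum_b T c a b * T c a b ->
  S <= 1.
Proof.
move=> r0 HS Sh gT E.
have cs c : (H * g c) ^+ 2 <= S * \sum_a \sum_b T c a b * T c a b.
  rewrite gT Sh !pair_big /=.
  exact: (cauchy_schwarz (fun p => h p.1 p.2) (fun p => T c p.1 p.2)).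
have S0 : 0 <= S.
  by rewrite Sh; do 2!apply: sumr_ge0 => ? _; rewrite -expr2 sqr_ge0.
set TT := \sum_c _ in E; set G := \sum_c _ in E.
have TT0 : 0 <= TT.
  by do 3!apply: sumr_ge0 => ? _; rewrite -expr2 sqr_ge0.
have HG : H * H * G <= S * TT.
  rewrite !mulr_sumr; apply: ler_sum => c _.
  by apply: le_trans (cs c); rewrite expr2 mulrACA.
rewrite leNgt; apply/negP => S1.
have HH : H * H = S + r by lra.
have HH0 : 0 < H * H by rewrite HH; lra.
have : H * H * (r * (1 - S)) < 0.
  by rewrite pmulr_rlt0// pmulr_rlt0// subr_lt0.
have -> : r * (1 - S) = TT - G by rewrite -E addrK.
rewrite mulrBr ltNge subr_ge0 => /negP; apply.
apply: le_trans HG _; rewrite HH mulrDl lerDl mulr_ge0// ltW//.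
Qed.

Section Hypersurface.
Variables (R : realType) (n : nat) (U : set 'rV[R]_n) (oU : open U).
Local Notation V := 'rV[R]_n.
Local Notation W := 'rV[R]_n.+1.
Variables (F N : V -> W) (w : 'I_n -> V -> V).
Let t i x : W := 'D_(w i x) F x.
Hypothesis F_smooth : smooth_on U F.
Hypothesis N_smooth : smooth_on U N.
Hypothesis w_smooth : forall i, smooth_on U (w i).
Hypothesis F_inj : forall x, U x -> forall v, 'D_v F x = 0 -> v = 0.
Hypothesis t_orth : forall x, U x -> forall i j, dot (t i x) (t j x) = (i == j)%:R.
Hypothesis N_unit : forall x, U x -> dot (N x) (N x) = 1.
Hypothesis N_orth : forall x, U x -> forall v, dot ('D_v F x) (N x) = 0.

Let sF b : smooth U (fun x => F x 0 b).
Proof. exact: smooth_on_coord. Qed.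

Let sN b : smooth U (fun x => N x 0 b).
Proof. exact: smooth_on_coord. Qed.

Let sw i j : smooth U (fun x => w i x 0 j).
Proof. exact: smooth_on_coord. Qed.

Let dF x : U x -> differentiable F x.
Proof. exact: smooth_on_differentiable. Qed.

Lemma tangent_coord i x b : U x -> t i x 0 b = 'D_(w i x) (fun y => F y 0 b) x.
Proof. by move=> Ux; rewrite derive_coord//; exact: dF. Qed.

Lemma tangent_smooth i b : smooth U (fun x => t i x 0 b).
Proof.
apply: smooth_ext (smooth_derive_field oU (sw i) (sF b)) => // x Ux.
by rewrite tangent_coord.
Qed.

Lemma tangent_complete x : U x -> forall a b,
  \sum_i t i x 0 a * t i x 0 b = (a == b)%:R - N x 0 a * N x 0 b.
Proof.
move=> Ux; apply: orthonormal_complete; first exact: t_orth.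
  exact: N_unit.
by move=> i; exact: N_orth.
Qed.

Lemma tangent_expand x (y : W) : U x ->
  \sum_i dot y (t i x) *: t i x = y - dot y (N x) *: N x.
Proof.
move=> Ux; apply/rowP => b; rewrite summxE !mxE.
transitivity (\sum_a y 0 a * \sum_i t i x 0 a * t i x 0 b).
  under [RHS]eq_bigr do rewrite mulr_sumr.
  rewrite exchange_big; apply: eq_bigr => i _ /=.
  by rewrite mxE mulr_suml; apply: eq_bigr => a _; rewrite mulrA.
under eq_bigr do rewrite tangent_complete// mulrBr mulrA.
rewrite sumrB -mulr_suml -/(dot y (N x)); congr (_ - _).
rewrite (bigD1 b)//= eqxx mulr1 big1 ?addr0// => a /negbTE ->.
by rewrite mulr0.
Qed.

(* The tangential part of the ambient basis vector [a], as a vector field on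
   the parameter domain. *)
Definition ambient_field (a : 'I_n.+1) (x : V) : V := \sum_i t i x 0 a *: w i x.

Lemma ambient_field_smooth a j : smooth U (fun x => ambient_field a x 0 j).
Proof.
have : smooth U (fun x => \sum_i t i x 0 a * w i x 0 j).
  by apply: smooth_sum => // i _; apply: smoothM => //; exact: tangent_smooth.
apply: smooth_ext => // x Ux; rewrite /ambient_field summxE.
by apply: eq_bigr => i _; rewrite mxE.
Qed.

(** The two sides have the same image under the differential of [F], as ['D_u F x] has no normal
    component, and that differential is injective. *)
Lemma frame_expand x u : U x -> u = \sum_i dot ('D_u F x) (t i x) *: w i x.
Proof.
move=> Ux; apply/eqP; rewrite -subr_eq0; apply/eqP; apply: (F_inj Ux).
set c := \sum_i _.
have Ec : 'D_c F x = \sum_i dot ('D_u F x) (t i x) *: t i x.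
  exact: (derive_linear_comb _ _ _ (dF Ux)).
have -> : 'D_(u - c) F x = 'D_u F x - 'D_c F x.
  by rewrite !deriveE ?linearB//; exact: dF.
by rewrite Ec tangent_expand// N_orth// scale0r subr0 subrr.
Qed.

(** Specialized to a Lie bracket, this is the source of [d_comm]. *)
Lemma ambient_expand x u : U x ->
  u = \sum_a 'D_u (fun y => F y 0 a) x *: ambient_field a x.
Proof.
move=> Ux; rewrite {1}(frame_expand u Ux).
transitivity (\sum_i \sum_a ('D_u F x 0 a * t i x 0 a) *: w i x).
  by apply: eq_bigr => i _; rewrite -scaler_suml.
rewrite exchange_big; apply: eq_bigr => a _ /=.
rewrite (derive_coord u a (dF Ux)) scaler_sumr.
by apply: eq_bigr => i _; rewrite scalerA.
Qed.

Let A := smooth_fun oU.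
Let d (a : 'I_n.+1) : A -> A := derivation (ambient_field_smooth a).
Let Xa (a : 'I_n.+1) : A := restrict oU (sF a).
Let Na (a : 'I_n.+1) : A := restrict oU (sN a).

Let dE a f x : U x -> value (d a f) x = 'D_(ambient_field a x) (value f) x.
Proof. exact: derivationE. Qed.

Let XaE a x : U x -> value (Xa a) x = F x 0 a.
Proof. exact: restrictE. Qed.

Let NaE a x : U x -> value (Na a) x = N x 0 a.
Proof. exact: restrictE. Qed.

Let derive_Xa v a x : U x -> 'D_v (value (Xa a)) x = 'D_v (fun y => F y 0 a) x.
Proof. by move=> Ux; apply: (eq_on_derive v oU Ux) => y; exact: XaE. Qed.

Let derive_Na v a x : U x -> 'D_v (value (Na a)) x = 'D_v (fun y => N y 0 a) x.
Proof. by move=> Ux; apply: (eq_on_derive v oU Ux) => y; exact: NaE. Qed.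

Let value_differentiable (f : A) x : U x -> differentiable (value f) x.
Proof. exact: (smooth_differentiable (value_smooth f)). Qed.

Let dX a b : d a (Xa b) = (a == b)%:R - Na a * Na b.
Proof.
apply: value_inj => x Ux.
rewrite dE// derive_Xa// valueD// valueN// valueM// value_bool// !NaE//.
rewrite -tangent_complete// derive_linear_comb; last first.
  exact: (smooth_differentiable (sF b) Ux).
by apply: eq_bigr => i _; rewrite -tangent_coord.
Qed.

Let unitN : \sum_a Na a * Na a = 1.
Proof.
apply: value_inj => x Ux; rewrite value_sum// value1// -(N_unit Ux).
by apply: eq_bigr => a _; rewrite valueM// NaE.
Qed.

Lemma ambient_field_normal x : U x -> \sum_a N x 0 a *: ambient_field a x = 0.
Proof.
move=> Ux; rewrite /ambient_field; under eq_bigr do rewrite scaler_sumr.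
rewrite exchange_big big1 //= => i _.
under eq_bigr do rewrite scalerA.
by rewrite -scaler_suml -[X in X *: _]/(dot (N x) (t i x)) dotC N_orth ?scale0r.
Qed.

Let dN0 f : \sum_a Na a * d a f = 0.
Proof.
apply: value_inj => x Ux; rewrite value_sum// value0//.
transitivity ('D_(\sum_a N x 0 a *: ambient_field a x) (value f) x).
  rewrite derive_linear_comb; last exact: value_differentiable.
  by apply: eq_bigr => a _; rewrite valueM// NaE// dE.
by rewrite ambient_field_normal// derive0.
Qed.

Let value_dd a b (f : A) x : U x -> value (d a (d b f)) x
  = 'D_(ambient_field a x) (fun y => 'D_(ambient_field b y) (value f) y) x.
Proof.
by move=> Ux; rewrite dE//; apply: (eq_on_derive _ oU Ux) => y; exact: dE.
Qed.

Let d_comm a b f :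
  d a (d b f) - d b (d a f) = \sum_c (d a (d b (Xa c)) - d b (d a (Xa c))) * d c f.
Proof.
apply: value_inj => x Ux.
have E (g : A) := derive_commutator oU (ambient_field_smooth a)
  (ambient_field_smooth b) (value_smooth g) Ux.
rewrite valueD// valueN// !value_dd// E.
set z := \row_j _.
rewrite value_sum// {1}(ambient_expand z Ux) derive_linear_comb; last first.
  exact: value_differentiable.
apply: eq_bigr => c _; rewrite valueM// valueD// valueN// !value_dd// E dE//.
by rewrite derive_Xa.
Qed.

Let double_inj (f : A) : f + f = 0 -> f = 0.
Proof.
move=> ff; apply: value_inj => x Ux; rewrite value0//.
have := congr1 (fun g : A => value g x) ff; rewrite valueD// value0//.
by lra.
Qed.

Let h : 'I_n.+1 -> 'I_n.+1 -> A := shape d Na.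
Let dD a f g : d a (f + g) = d a f + d a g := derivationD _ f g.
Let dM a f g : d a (f * g) = d a f * g + f * d a g := derivationM _ f g.

Definition second_form (x : V) (i j : 'I_n) : R := dot ('D_(w j x) (t i) x) (N x).

(** Weingarten relation: differentiate the orthogonality of [t i] and [N] along [w j]. *)
Lemma second_form_normal x i j : U x ->
  second_form x i j = - \sum_b t i x 0 b * 'D_(w j x) (fun y => N y 0 b) x.
Proof.
move=> Ux; apply/eqP; rewrite -addr_eq0; apply/eqP.
have dt : differentiable (t i) x.
  by apply: differentiable_coords => b; exact: (smooth_differentiable (tangent_smooth i b) Ux).
have E0 : 'D_(w j x) (fun y => \sum_b t i y 0 b * N y 0 b) x = 0.
  rewrite -[RHS](derive_cst 0 x (w j x)).
  by apply: (eq_on_derive _ oU Ux) => y Uy; exact: N_orth.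
rewrite -[RHS]E0 (derive_sum_smooth _ _ oU _ Ux); last first.
  by move=> b; apply: smoothM => //; exact: tangent_smooth.
rewrite /second_form /dot -big_split; apply: eq_bigr => b _ /=.
rewrite (deriveM_smooth _ (tangent_smooth i b) (sN b) Ux).
by rewrite (derive_coord _ _ dt).
Qed.

Lemma second_form_shape x i j : U x -> second_form x i j =
  - \sum_b \sum_c t i x 0 b * (t j x 0 c * value (h c b) x).
Proof.
move=> Ux.
have E b : 'D_(w j x) (fun y => N y 0 b) x = \sum_c t j x 0 c * value (h c b) x.
  rewrite {1}(ambient_expand (w j x) Ux) derive_linear_comb; last first.
    exact: (smooth_differentiable (sN b) Ux).
  apply: eq_bigr => c _; rewrite -(tangent_coord _ _ Ux) /h /shape (dE _ _ Ux).
  by rewrite (derive_Na _ _ Ux).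
rewrite (second_form_normal _ _ Ux); congr (- _); apply: eq_bigr => b _.
by rewrite E mulr_sumr.
Qed.

Lemma second_form_sym x i j : U x -> second_form x i j = second_form x j i.
Proof.
move=> Ux; rewrite (second_form_shape i j Ux) (second_form_shape j i Ux); congr (- _); rewrite exchange_big.
apply: eq_bigr => b _; apply: eq_bigr => c _ /=.
by rewrite /h (shape_sym dD dM dX unitN d_comm double_inj c); ring.
Qed.

Lemma shape_normal x a : U x -> \sum_b value (h a b) x * N x 0 b = 0.
Proof.
move=> Ux; apply: etrans _ (value0 oU Ux).
rewrite -(shapeN dD dM unitN double_inj a) value_sum//.
by apply: eq_bigr => b _; rewrite valueM// NaE.
Qed.

(** Passage between the [n] frame vectors and the n + 1 ambient directions: the tangential
    projection [(T x)^T *m T x] is absorbed by [hM x], so cyclicity of the trace identifies the two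
    versions of the mean curvature and of the squared norm. *)
Let T x : 'M[R]_(n, n.+1) := \matrix_(i, b) t i x 0 b.
Let hM x : 'M[R]_n.+1 := \matrix_(a, b) value (h a b) x.

Let hM_sym x : U x -> (hM x)^T = hM x.
Proof.
by move=> Ux; apply/matrixP => a b; rewrite !mxE /h
  (shape_sym dD dM dX unitN d_comm double_inj a).
Qed.

Let TT x : U x -> (T x)^T *m T x = 1%:M - (N x)^T *m N x.
Proof.
move=> Ux; apply/matrixP => a b; rewrite !mxE big_ord1 !mxE -tangent_complete//.
by apply: eq_bigr => i _; rewrite !mxE.
Qed.

Let hMN x : U x -> hM x *m (N x)^T = 0.
Proof.
move=> Ux; apply/matrixP => a b; rewrite !mxE -[RHS](shape_normal a Ux).
by apply: eq_bigr => c _; rewrite !mxE (ord1 b).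
Qed.

Let NhM x : U x -> N x *m hM x = 0.
Proof. by move=> Ux; apply: trmx_inj; rewrite trmx_mul hM_sym// hMN// trmx0. Qed.

Let second_formM x : U x ->
  \matrix_(i, j) second_form x i j = - (T x *m hM x *m (T x)^T).
Proof.
move=> Ux; apply/matrixP => i j; rewrite !mxE (second_form_shape _ _ Ux); congr (- _).
rewrite exchange_big; apply: eq_bigr => c _ /=.
rewrite !mxE mulr_suml; apply: eq_bigr => b _; rewrite !mxE.
by rewrite /h (shape_sym dD dM dX unitN d_comm double_inj c); ring.
Qed.

Lemma second_form_trace x : U x ->
  \sum_i second_form x i i = - value (trace_shape d Na) x.
Proof.
move=> Ux; transitivity (\tr (\matrix_(i, j) second_form x i j)).
  by apply: eq_bigr => i _; rewrite mxE.
rewrite second_formM// linearN /= mxtrace_mulC mulmxA TT// mulmxBl mul1mx.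
rewrite -mulmxA NhM// mulmx0 subr0; congr (- _).
by rewrite value_sum//; apply: eq_bigr => a _; rewrite mxE.
Qed.

Lemma second_form_normsq x : U x ->
  \sum_i \sum_j second_form x i j ^+ 2 = value (normsq_shape d Na) x.
Proof.
move=> Ux; set q := \matrix_(i, j) second_form x i j.
transitivity (\tr (q *m q^T)).
  apply: eq_bigr => i _; rewrite mxE; apply: eq_bigr => j _.
  by rewrite !mxE expr2.
transitivity (\tr (hM x *m hM x)); last first.
  rewrite value_sum//; apply: eq_bigr => a _; rewrite mxE value_sum//.
  by apply: eq_bigr => b _; rewrite -{2}(hM_sym Ux) !mxE valueM.
have hTT : hM x *m ((T x)^T *m T x) = hM x.
  by rewrite TT// mulmxBr mulmx1 mulmxA hMN// mul0mx subr0.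
have -> : q *m q^T = T x *m (hM x *m ((T x)^T *m T x) *m (hM x *m (T x)^T)).
  rewrite /q second_formM// linearN /= mulNmx mulmxN opprK !trmx_mul trmxK.
  by rewrite hM_sym// !mulmxA.
by rewrite hTT mxtrace_mulC -!mulmxA hTT.
Qed.

Lemma shrinker_bound (r : R) : 0 < r ->
  (forall x, U x -> \sum_i second_form x i i + dot (F x) (N x) = 0) ->
  (forall x, U x -> (\sum_i second_form x i i) ^+ 2
     - \sum_i \sum_j second_form x i j ^+ 2 = r) ->
  forall x, U x -> \sum_i \sum_j second_form x i j ^+ 2 <= 1.
Proof.
move=> r0 shrink scal x Ux.
(* [shape] is minus the second fundamental form, so the shrinker equation carries no sign here. *)
have traceE : trace_shape d Na = \sum_a Xa a * Na a.
  apply: value_inj => y Uy; have := shrink y Uy.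
  rewrite second_form_trace// => /eqP; rewrite addrC subr_eq0 => /eqP <-.
  by rewrite value_sum//; apply: eq_bigr => a _; rewrite valueM// XaE// NaE.
pose rA : A := restrict oU (smooth_cst U r).
have dr a : d a rA = 0.
  apply: value_inj => y Uy; rewrite dE// value0//.
  rewrite -[RHS](derive_cst r y (ambient_field a y)).
  by apply: (eq_on_derive _ oU Uy) => z Uz; exact: restrictE.
have scalE : trace_shape d Na * trace_shape d Na - normsq_shape d Na = rA.
  apply: value_inj => y Uy; rewrite valueD// valueN// valueM// restrictE//.
  by rewrite -(scal y Uy) second_form_trace// second_form_normsq// sqrrN.
have := simons_constant_scalar dD dM dX unitN dN0 d_comm double_inj traceE dr scalE.
have := shape_codazzi_tensor dD dM dX unitN d_comm double_inj dr scalE.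
move=> gT E; rewrite second_form_normsq//.
apply: (@shape_bound R n.+1 _ r (value (trace_shape d Na) x)
  (fun c => value (d c (trace_shape d Na)) x) (fun a b => value (h a b) x)
  (fun c a b => value (codazzi_tensor d Na c a b) x) r0).
- by have := restrictE oU (smooth_cst U r) Ux;
    rewrite -/rA -scalE valueD// valueN// valueM.
- rewrite value_sum//; apply: eq_bigr => a _; rewrite value_sum//.
  by apply: eq_bigr => b _; rewrite valueM.
- move=> c; rewrite -valueM// -gT value_sum//; apply: eq_bigr => a _.
  by rewrite value_sum//; apply: eq_bigr => b _; rewrite valueM.
- have := congr1 (fun f : A => value f x) E.
  rewrite valueD// valueM// valueD// valueN// value1// restrictE//.
  have -> : value (\sum_c d c (trace_shape d Na) * d c (trace_shape d Na)) x
      = \sum_c value (d c (trace_shape d Na)) x * value (d c (trace_shape d Na)) x.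
    by rewrite value_sum//; apply: eq_bigr => c _; rewrite valueM.
  move=> ->; rewrite value_sum//; apply: eq_bigr => c _.
  rewrite value_sum//; apply: eq_bigr => a _.
  by rewrite value_sum//; apply: eq_bigr => b _; rewrite valueM.
Qed.

End Hypersurface.

(** * Gauss equation *)

(** Flatness of Euclidean space: iterated derivatives of [Y] commute up to the bracket. *)
Lemma dot_derive_commutator (R : realType) (n m : nat) (U : set 'rV[R]_n)
    (u w : 'rV[R]_n -> 'rV[R]_n) (Y : 'rV[R]_n -> 'rV[R]_m) (v : 'rV[R]_m) x :
  open U -> (forall j, smooth U (fun x => u x 0 j)) ->
  (forall j, smooth U (fun x => w x 0 j)) ->
  (forall b, smooth U (fun x => Y x 0 b)) -> U x ->
  \sum_b 'D_(u x) (fun y => 'D_(w y) (fun z => Y z 0 b) y) x * v 0 b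
  - \sum_b 'D_(w x) (fun y => 'D_(u y) (fun z => Y z 0 b) y) x * v 0 b
  = dot ('D_(lie_bracket u w x) Y x) v.
Proof.
move=> oU su sw sY Ux.
have du (f : 'rV[R]_n -> 'rV[R]_n) : (forall j, smooth U (fun x => f x 0 j)) ->
    differentiable f x.
  by move=> sf; apply: differentiable_coords => k; exact: (smooth_differentiable (sf k) Ux).
have dY : differentiable Y x.
  by apply: differentiable_coords => k; exact: (smooth_differentiable (sY k) Ux).
have -> : lie_bracket u w x
    = \row_j ('D_(u x) (fun y => w y 0 j) x - 'D_(w x) (fun y => u y 0 j) x).
  apply/rowP => k; rewrite !mxE.
  apply: (congr2 (fun p q => p - q)); apply: esym.
    exact: derive_coord (u x) k (du _ sw).
  exact: derive_coord (w x) k (du _ su).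
rewrite -sumrB; apply: eq_bigr => b _; rewrite -mulrBl; congr (_ * _).
apply: etrans (derive_commutator oU su sw (sY b) Ux) _.
exact: (derive_coord _ _ dY).
Qed.

Section Gauss.
Variables (R : realType) (n : nat) (M : smooth_manifold R n).
Variables (X : M -> 'rV[R]_n.+1) (X_imm : immersion X) (e : adapted_frame X).
Local Notation V := 'rV[R]_n.
Local Notation W := 'rV[R]_n.+1.
Local Notation U := (fdom e).
Local Notation N := (fnormal e).
Let oU : open U := fdom_open (a := e).

Lemma floc_smooth : smooth_on U (floc e).
Proof.
have [sX _] := X_imm (fchart_atlas e).
exact: smooth_on_sub (fdom_img (a := e)) sX.
Qed.

Lemma floc_inj x : U x -> forall v, 'D_v (floc e) x = 0 -> v = 0.
Proof.
move=> Ux; have [_ +] := X_imm (fchart_atlas e); apply.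
exact: fdom_img Ux.
Qed.

Let sN b : smooth U (fun x => N x 0 b).
Proof. exact: smooth_on_coord (fnormal_smooth e). Qed.

Lemma levi_civitaE u (Y : V -> W) x : U x ->
  levi_civita e u Y x = 'D_(u x) Y x - dot ('D_(u x) Y x) (N x) *: N x.
Proof.
move=> Ux; apply: (@tangent_expand R n U (floc e) N (fvec e)) => //.
- exact: ftan_orthonormal.
- exact: fnormal_unit.
- exact: fnormal_orth.
Qed.

Lemma dot_levi_civita u (Y : V -> W) x i : U x ->
  dot (levi_civita e u Y x) (ftan e i x) = dot ('D_(u x) Y x) (ftan e i x).
Proof.
move=> Ux; rewrite (levi_civitaE _ _ Ux) dotBl dotZl (dotC (N x)).
have -> : dot (ftan e i x) (N x) = 0 := fnormal_orth Ux (fvec e i x).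
by rewrite mulr0 subr0.
Qed.

Section SecondDerivative.
Variables (u w : V -> V) (Y : V -> W).
Hypothesis sw : forall j, smooth U (fun x => w x 0 j).
Hypothesis sY : forall b, smooth U (fun x => Y x 0 b).

Let dY x : U x -> differentiable Y x.
Proof.
by move=> Ux; apply: differentiable_coords => b; exact: (smooth_differentiable (sY b) Ux).
Qed.

Let DY b y := 'D_(w y) (fun z => Y z 0 b) y.

Let sDY b : smooth U (DY b).
Proof. exact: smooth_derive_field. Qed.

Let sDYN : smooth U (fun y => \sum_c DY c y * N y 0 c).
Proof. by apply: smooth_sum => // c _; exact: smoothM. Qed.

Let lc_coord b y : U y ->
  levi_civita e w Y y 0 b = DY b y - (\sum_c DY c y * N y 0 c) * N y 0 b.
Proof.
move=> Uy; have E c : 'D_(w y) Y y 0 c = DY c y.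
  by rewrite -(derive_coord _ _ (dY Uy)).
rewrite (levi_civitaE _ _ Uy) mxE mxE mxE E /dot.
by under eq_bigr do rewrite E.
Qed.

(** The inner connection subtracts from the derivative of [Y] a multiple of [N]. When that product
    is differentiated and paired with a tangent vector, only the derivative of the factor [N]
    survives. *)
Lemma dot_levi_civita2 x i : U x ->
  dot (levi_civita e u (levi_civita e w Y) x) (ftan e i x) =
  \sum_b 'D_(u x) (fun y => 'D_(w y) (fun z => Y z 0 b) y) x * ftan e i x 0 b
  - dot ('D_(w x) Y x) (N x) * \sum_b ftan e i x 0 b * 'D_(u x) (fun y => N y 0 b) x.
Proof.
move=> Ux; rewrite dot_levi_civita//.
have slc b : smooth U (fun y => levi_civita e w Y y 0 b).
  have := smoothB oU (sDY b) (smoothM oU sDYN (sN b)).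
  by apply: smooth_ext => // y Uy; rewrite lc_coord.
have dlc : differentiable (levi_civita e w Y) x.
  by apply: differentiable_coords => b; exact: (smooth_differentiable (slc b) Ux).
have E b : 'D_(u x) (levi_civita e w Y) x 0 b = 'D_(u x) (DY b) x
    - ('D_(u x) (fun y => \sum_c DY c y * N y 0 c) x * N x 0 b
       + dot ('D_(w x) Y x) (N x) * 'D_(u x) (fun y => N y 0 b) x).
  rewrite -(derive_coord _ _ dlc).
  rewrite (eq_on_derive _ oU Ux (fun y Uy => lc_coord b Uy)).
  rewrite (deriveB_smooth _ (sDY b) (smoothM oU sDYN (sN b)) Ux).
  rewrite (deriveM_smooth _ sDYN (sN b) Ux).
  have -> : \sum_c DY c x * N x 0 c = dot ('D_(w x) Y x) (N x).
    by apply: eq_bigr => c _; rewrite -(derive_coord _ _ (dY Ux)).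
  by [].
have Nt : \sum_b N x 0 b * ftan e i x 0 b = 0.
  by rewrite -[LHS]/(dot (N x) (ftan e i x)) dotC (fnormal_orth (a := e) Ux).
pose c1 := 'D_(u x) (fun y => \sum_c DY c y * N y 0 c) x.
set c0 := dot _ (N x) in E *.
rewrite [LHS]/dot; under eq_bigr do rewrite E.
transitivity (\sum_b ('D_(u x) (DY b) x * ftan e i x 0 b
   - c1 * (N x 0 b * ftan e i x 0 b)
   - c0 * (ftan e i x 0 b * 'D_(u x) (fun y => N y 0 b) x))).
  by apply: eq_bigr => b _; rewrite -/c1; ring.
by rewrite !sumrB -!mulr_sumr Nt mulr0 subr0.
Qed.

End SecondDerivative.

Let sw i j : smooth U (fun x => fvec e i x 0 j).
Proof. exact: smooth_on_coord (fvec_smooth e i). Qed.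

Let st i b : smooth U (fun x => ftan e i x 0 b).
Proof. exact: (tangent_smooth oU floc_smooth (fvec_smooth e)). Qed.

Local Notation II := (second_form (floc e) N (fvec e)).

(** By flatness the Euclidean second derivatives cancel against the bracket term; the normal
    corrections of [dot_levi_civita2] remain, each a product of two entries of [II] by the
    Weingarten relation. *)
Lemma gauss_equation x i j : U x ->
  dot (riemann e (fvec e i) (fvec e j) (ftan e j) x) (ftan e i x)
  = II x i i * II x j j - II x i j ^+ 2.
Proof.
move=> Ux; rewrite /riemann !dotBl.
have E1 := @dot_levi_civita2 (fvec e i) (fvec e j) (ftan e j) (sw j) (st j) x i Ux.
have E2 := @dot_levi_civita2 (fvec e j) (fvec e i) (ftan e j) (sw i) (st j) x i Ux.
have E3 := dot_levi_civita (lie_bracket (fvec e i) (fvec e j)) (ftan e j) i Ux.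
apply: etrans (congr2 (fun p q => p - q) (congr2 (fun p q => p - q) E1 E2) E3) _.
clear E1 E2 E3.
have Z := dot_derive_commutator (ftan e i x) oU (sw i) (sw j) (st j) Ux.
have IIE k l : \sum_b ftan e k x 0 b * 'D_(fvec e l x) (fun y => N y 0 b) x = - II x k l.
  rewrite (second_form_normal oU floc_smooth (fnormal_smooth e) (fvec_smooth e)
    (fnormal_orth (a := e)) k l Ux).
  by rewrite opprK.
have IIsym : II x i j = II x j i.
  exact: (second_form_sym oU floc_smooth (fnormal_smooth e) (fvec_smooth e) floc_inj
  (ftan_orthonormal (a := e)) (fnormal_unit (a := e)) (fnormal_orth (a := e)) i j Ux).
have alg (p q l s a k b t : R) : p - q = l -> a = - t -> b = - k ->
    p - s * a - (q - k * b) - l = t * s - k ^+ 2.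
  by move=> <- -> ->; ring.
rewrite [II x i j]IIsym.
exact: (alg _ _ _ (II x j j) _ (II x j i) _ (II x i i) Z (IIE i i)
  (etrans (IIE i j) (congr1 -%R IIsym))).
Qed.

Lemma scalar_curvatureE p : frame_at e p ->
  scalar_curvature e p = mean_curvature e p ^+ 2 - sff_normsq e p.
Proof.
move=> [_ Ux].
have alg (h : 'I_n -> 'I_n -> R) :
    \sum_i \sum_j (h i i * h j j - h i j ^+ 2)
    = (\sum_i h i i) ^+ 2 - \sum_i \sum_j h i j ^+ 2.
  under eq_bigr do rewrite sumrB -mulr_sumr.
  by rewrite sumrB -mulr_suml expr2.
apply: etrans (alg (sff e p)).
by apply: eq_bigr => i _; apply: eq_bigr => j _; exact: gauss_equation.
Qed.

End Gauss.

(** The geometric assumptions range over points of [M], whereas [shrinker_bound] works on the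
    parameter domain; every parameter in [fdom] comes from a point. *)
Lemma frame_atE (R : realType) (n : nat) (M : smooth_manifold R n)
    (X : M -> 'rV[R]_n.+1) (e : adapted_frame X) x : fdom e x ->
  exists p, [/\ frame_at e p, fwd (fchart e) p = x & X p = floc e x].
Proof.
move=> Ux; have [p pd px] := fdom_img Ux.
exists p; rewrite /frame_at px; split=> //.
by rewrite /floc /= -px fwdK.
Qed.

(** * Bounds at a point covered by an adapted frame *)

Section FrameBound.
Variables (R : realType) (n : nat) (M : smooth_manifold R n).
Variables (X : M -> 'rV[R]_n.+1) (r : R) (X_shrinker : self_shrinker X).
Hypothesis r_gt0 : 0 < r.
Hypothesis scal_const : forall (p : M) (e : adapted_frame X),
  frame_at e p -> scalar_curvature e p = r.

Lemma sff_normsq_le1 p (e : adapted_frame X) : frame_at e p -> sff_normsq e p <= 1.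
Proof.
have [X_imm shrink] := X_shrinker; move=> ep; have [_ Ux] := ep.
have shrinkU y : fdom e y -> \sum_i second_form (floc e) (fnormal e) (fvec e) y i i
    + dot (floc e y) (fnormal e y) = 0.
  move=> Uy; have [q [eq qy Xq]] := frame_atE Uy.
  by have := shrink q e eq; rewrite Xq /mean_curvature /sff /normal_at qy.
have scalU y : fdom e y ->
    (\sum_i second_form (floc e) (fnormal e) (fvec e) y i i) ^+ 2
    - \sum_i \sum_j second_form (floc e) (fnormal e) (fvec e) y i j ^+ 2 = r.
  move=> Uy; have [q [eq qy _]] := frame_atE Uy.
  have := scal_const eq; rewrite (scalar_curvatureE X_imm eq).
  by rewrite /mean_curvature /sff_normsq /sff qy.
exact: (shrinker_bound (fdom_open (a := e)) (floc_smooth X_imm e) (fnormal_smooth e)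
  (fvec_smooth e) (floc_inj X_imm (e := e)) (ftan_orthonormal (a := e))
  (fnormal_unit (a := e)) (fnormal_orth (a := e)) r_gt0 shrinkU scalU Ux).
Qed.

Lemma scalar_curvature_le p (e : adapted_frame X) : frame_at e p -> r <= n%:R - 1.
Proof.
move=> ep; have S1 := sff_normsq_le1 ep.
have [X_imm _] := X_shrinker.
have E := scal_const ep; rewrite (scalar_curvatureE X_imm ep) in E.
have HS : mean_curvature e p ^+ 2 <= n%:R * sff_normsq e p.
  have := cauchy_schwarz (fun=> 1) (fun i => sff e p i i).
  under eq_bigr do rewrite mul1r.
  under [X in _ <= X * _]eq_bigr do rewrite mulr1.
  rewrite sumr_const card_ord => /le_trans; apply.
  rewrite ler_wpM2l// ler_sum// => i _.
  rewrite (bigD1 i)//= -expr2 lerDl sumr_ge0// => j _.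
  exact: sqr_ge0.
have S0 : 0 <= sff_normsq e p by do 2!apply: sumr_ge0 => ? _; exact: sqr_ge0.
move: (sff_normsq e p) (mean_curvature e p ^+ 2) E HS S1 S0 => S H2 E HS S1 S0.
(* For [n = 0] the factor [n%:R - 1] is negative and the final multiplication would reverse the
   inequality; there [HS] makes [H2] nonpositive, against [r_gt0]. *)
have [n0|n0] := posnP n.
  by move: HS r_gt0; rewrite n0 mul0r => HS r0; lra.
have : (n%:R - 1) * S <= (n%:R - 1) * 1.
  by rewrite ler_wpM2l// subr_ge0 ler1n.
by rewrite mulr1 mulrBl mul1r; lra.
Qed.

End FrameBound.

(** * Existence of adapted frames *)

(** Used at one point to start Gram-Schmidt: for a tangent direction orthogonal to fewer than n
    tangent vectors, and for a vector of R^(n+1) orthogonal to n of them. *)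
Lemma nontrivial_solution (K : fieldType) (p k : nat) (f : 'I_p -> 'I_k -> K) :
  (k < p)%N -> exists2 v : 'rV[K]_p, v != 0 & forall i, \sum_j v 0 j * f j i = 0.
Proof.
move=> kp; pose B := \matrix_(j, i) f j i.
have /rowV0Pn [v vB v0] : kermx B != 0.
  by rewrite -mxrank_eq0 mxrank_ker -lt0n subn_gt0 (leq_ltn_trans (rank_leq_col B)).
exists v => // i; move: vB; rewrite sub_kermx => /eqP /matrixP /(_ 0 i).
by rewrite !mxE; apply: etrans; apply: eq_bigr => j _; rewrite mxE.
Qed.

Section GramSchmidt.
Variables (R : realType) (n m : nat).
Local Notation V := 'rV[R]_n.
Local Notation W := 'rV[R]_m.

Lemma smooth_dot (D : set V) (f g : V -> W) : open D ->
  (forall b, smooth D (fun x => f x 0 b)) ->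
  (forall b, smooth D (fun x => g x 0 b)) -> smooth D (fun x => dot (f x) (g x)).
Proof. by move=> oD sf sg; apply: smooth_sum => // b _; exact: smoothM. Qed.

Definition orth_part (I : finType) (P : pred I) (T : I -> W) (g : W) : W :=
  g - \sum_(i | P i) dot g (T i) *: T i.

(** At [x0] the orthogonal part is [G x0] itself, hence nonzero; by continuity its squared norm
    stays positive nearby, where it can be normalized smoothly. *)
Lemma gram_schmidt_step (D : set V) x0 (I : finType) (P : pred I)
    (T : I -> V -> W) (G : V -> W) : open D -> D x0 ->
  (forall i b, P i -> smooth D (fun x => T i x 0 b)) ->
  (forall x, D x -> forall i j, P i -> P j -> dot (T i x) (T j x) = (i == j)%:R) ->
  (forall b, smooth D (fun x => G x 0 b)) ->
  G x0 != 0 -> (forall i, P i -> dot (G x0) (T i x0) = 0) ->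
  exists (D' : set V) (s : V -> R), [/\ open D', D' `<=` D, D' x0, smooth D' s &
    forall x, D' x ->
      let g := s x *: orth_part P (T^~ x) (G x) in
      dot g g = 1 /\ forall i, P i -> dot g (T i x) = 0].
Proof.
move=> oD Dx0 sT TT sG G0 GT.
pose g x := orth_part P (T^~ x) (G x).
have sg b : smooth D (fun x => g x 0 b).
  have : smooth D (fun x => G x 0 b - \sum_(i | P i) dot (G x) (T i x) * T i x 0 b).
    apply: smoothB => //; apply: smooth_sum => // i Pi.
    by apply: smoothM => //; [apply: smooth_dot => // c|]; exact: sT.
  apply: smooth_ext => // x Dx; rewrite !mxE summxE; congr (_ - _).
  by apply: eq_bigr => i _; rewrite mxE.
pose q x := dot (g x) (g x).
have sq : smooth D q by exact: smooth_dot.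
have gx0 : g x0 = G x0.
  rewrite /g /orth_part big1 ?subr0// => i Pi.
  by rewrite GT// scale0r.
have q0 : 0 < q x0.
  rewrite /q gx0 lt_def dot_ge0 andbT; apply: contra G0 => /eqP /dot_eq0 ->.
  exact: eqxx.
pose D1 := D `&` [set x | 0 < q x].
have nD1 : nbhs x0 D1.
  apply: filterI; first exact: open_nbhs_nbhs.
  have cq : q y @[y --> x0] --> q x0 by exact: (sq 0%N x0 Dx0).
  by move/cvgr_gt : cq; apply.
exists (D1°), (fun x => rsqrt (q x)).
have oD1 : open (D1°) by exact: open_interior.
have D1D x : (D1°) x -> D x /\ 0 < q x by move=> /interior_subset [].
split=> //.
- by move=> x /D1D [].
- apply: smooth_rsqrt => //; first by move=> x /D1D [].
  by apply: (smooth_sub _ sq) => x /D1D [].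
- move=> x /D1D [Dx qx] /=; rewrite -/(g x); split.
    rewrite dotZl dotZr -/(q x) /rsqrt.
    have s0 : Num.sqrt (q x) != 0 by rewrite gt_eqF// sqrtr_gt0.
    by rewrite -{3}(sqr_sqrtr (ltW qx)) expr2; field.
  move=> i Pi; rewrite dotZl /g /orth_part dotBl.
  have -> : dot (\sum_(j | P j) dot (G x) (T j x) *: T j x) (T i x)
      = dot (G x) (T i x).
    rewrite -big_filter dot_suml big_filter (bigD1 i)//= dotZl TT// eqxx mulr1.
    rewrite big1 ?addr0// => j /andP[Pj ji].
    by rewrite dotZl TT// (negbTE ji) mulr0.
  by rewrite subrr mulr0.
Qed.

End GramSchmidt.

Section FrameExistence.
Variables (R : realType) (n : nat).
Local Notation V := 'rV[R]_n.
Local Notation W := 'rV[R]_n.+1.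
Variables (U : set V) (F : V -> W) (x0 : V).
Hypotheses (oU : open U) (Ux0 : U x0) (F_smooth : smooth_on U F).
Hypothesis F_inj : forall x, U x -> forall v, 'D_v F x = 0 -> v = 0.

Lemma derive_field_smooth (D : set V) (w : V -> V) b : open D -> D `<=` U ->
  (forall j, smooth D (fun x => w x 0 j)) ->
  smooth D (fun x => 'D_(w x) F x 0 b).
Proof.
move=> oD DU sw.
have sF : smooth D (fun x => F x 0 b).
  exact: smooth_sub DU (smooth_on_coord b oU F_smooth).
apply: smooth_ext (smooth_derive_field oD sw sF) => // x Dx.
by rewrite derive_coord//; exact: smooth_on_differentiable F_smooth (DU _ Dx).
Qed.

(** One field is added at a time, on a possibly smaller neighbourhood. All fields are indexed by
    ['I_n] with only the first [k] constrained, which avoids reindexing in the induction. *)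
Lemma orthonormal_fields (k : nat) : (k <= n)%N ->
  exists (D : set V) (w : 'I_n -> V -> V), [/\ open D, D `<=` U, D x0,
    forall i : 'I_n, (i < k)%N -> forall j, smooth D (fun x => w i x 0 j) &
    forall x, D x -> forall i j : 'I_n, (i < k)%N -> (j < k)%N ->
      dot ('D_(w i x) F x) ('D_(w j x) F x) = (i == j)%:R].
Proof.
elim: k => [|k IH] kn; first by exists U, (fun _ _ => 0); split.
have [D [w [oD DU Dx0 sw ww]]] := IH (ltnW kn).
have dF x : D x -> differentiable F x.
  by move=> /DU; exact: smooth_on_differentiable F_smooth.
pose T i x : W := 'D_(w i x) F x.
(* Fewer than [n] linear conditions on [v]: its image under the differential of [F] is to be
   orthogonal to the earlier tangent vectors at [x0]. *)
have [v v0 vT] := nontrivial_solution (fun (j : 'I_n) (i : 'I_k) =>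
  dot ('D_(delta_mx 0 j) F x0) (T (widen_ord (ltnW kn) i) x0)) kn.
pose G x : W := 'D_v F x.
have G0 : G x0 != 0 by apply: contra v0 => /eqP /(F_inj Ux0) ->.
have GT (i : 'I_n) : (i < k)%N -> dot (G x0) (T i x0) = 0.
  move=> ik; rewrite /G (derive_coords v (dF _ Dx0)) dot_suml.
  apply: etrans (vT (Ordinal ik)); apply: eq_bigr => j _; rewrite dotZl.
  have -> // : widen_ord (ltnW kn) (Ordinal ik) = i by exact: val_inj.
have sT (i : 'I_n) b : (i < k)%N -> smooth D (fun x => T i x 0 b).
  by move=> ik; apply: derive_field_smooth => // j; exact: sw.
have sG b : smooth D (fun x => G x 0 b).
  by apply: derive_field_smooth => // j; exact: smooth_cst.
have [D' [s [oD' D'D D'x0 ss gs]]] :=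
  gram_schmidt_step (P := fun i : 'I_n => (i < k)%N) oD Dx0 sT ww sG G0 GT.
(* Gram-Schmidt acts on the images in R^(n+1); by linearity of the differential, the same
   combination of the [w j] is a field with the required image. *)
pose wk x := s x *: (v - \sum_(j < n | (j < k)%N) dot (G x) (T j x) *: w j x).
have wkE x : D' x ->
    'D_(wk x) F x = s x *: @orth_part R n.+1 'I_n (fun j => (j < k)%N) (T^~ x) (G x).
  move=> /D'D /dF dFx; rewrite /orth_part /wk deriveE// linearZ linearB /=.
  rewrite linear_sum -deriveE//; congr (_ *: (_ - _)); apply: eq_bigr => j _.
  by rewrite linearZ /= -deriveE.
pose w' (i : 'I_n) x := if i == k :> nat then wk x else w i x.
have ltkP (i : 'I_n) : (i < k.+1)%N -> i = k :> nat \/ (i < k)%N.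
  by rewrite ltnS leq_eqVlt => /orP[/eqP|]; [left|right].
exists D', w'; split=> //.
- by apply: subset_trans D'D _.
- move=> i /ltkP [ik|ik] j; rewrite /w'; last first.
    by rewrite ltn_eqF//; apply: smooth_sub D'D _; exact: sw.
  rewrite ik eqxx.
  have : smooth D' (fun x => s x * (v 0 j
      - \sum_(i < n | (i < k)%N) dot (G x) (T i x) * w i x 0 j)).
    apply: smoothM => //; apply: smoothB => //; first exact: smooth_cst.
    apply: smooth_sum => // l lk; apply: smoothM => //; last first.
      by apply: smooth_sub D'D _; exact: sw.
    apply: (smooth_dot oD') => b; first exact: smooth_sub D'D (sG b).
    exact: smooth_sub D'D (sT l b lk).
  apply: smooth_ext => // x _; rewrite /wk !mxE summxE; congr (_ * (_ - _)).
  by apply: eq_bigr => l _; rewrite mxE.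
- move=> x D'x i j /ltkP [ik|ik] /ltkP [jk|jk]; rewrite /w'.
  + have -> : j = i by apply: val_inj; rewrite /= ik jk.
    by rewrite ik !eqxx wkE//; case: (gs x D'x).
  + rewrite ik eqxx (ltn_eqF jk) wkE//; case: (gs x D'x) => _ -> //.
    by case: eqP => // ij; move: jk; rewrite -ij ik ltnn.
  + rewrite jk eqxx (ltn_eqF ik) wkE// dotC; case: (gs x D'x) => _ -> //.
    by case: eqP => // ij; move: ik; rewrite ij jk ltnn.
  + by rewrite (ltn_eqF ik) (ltn_eqF jk); apply: ww => //; exact: D'D.
Qed.

(** Orthonormality of their images makes the [w i] linearly independent, so they span all directions
    [v]. *)
Lemma tangent_orth (w : 'I_n -> V) (N : W) x : U x ->
  (forall i j, dot ('D_(w i) F x) ('D_(w j) F x) = (i == j)%:R) ->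
  (forall i, dot N ('D_(w i) F x) = 0) -> forall v, dot ('D_v F x) N = 0.
Proof.
move=> Ux ww Nw v; have dF := smooth_on_differentiable F_smooth Ux.
pose B := \matrix_(i, j) w i 0 j.
have BE (c : 'rV_n) : c *m B = \sum_i c 0 i *: w i.
  rewrite mulmx_sum_row; apply: eq_bigr => i _; congr (_ *: _).
  by apply/rowP => j; rewrite !mxE.
have B_unit : B \in unitmx.
  rewrite -row_free_unit -kermx_eq0; apply/rowV0P => c.
  rewrite sub_kermx BE => /eqP cw; apply/rowP => j; rewrite mxE.
  have := congr1 (fun u => dot ('D_u F x) ('D_(w j) F x)) cw.
  rewrite derive0 dot0l (derive_linear_comb _ _ _ dF) dot_suml; apply: etrans.
  transitivity (\sum_i c 0 i * (i == j)%:R).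
    rewrite (bigD1 j)//= eqxx mulr1 big1 ?addr0// => i /negbTE ->.
    by rewrite mulr0.
  apply: eq_bigr => i _; apply: etrans (esym (dotZl _ _ _)).
  exact: (congr1 ( *%R (c 0 i)) (esym (ww i j))).
have -> : v = \sum_i (v *m invmx B) 0 i *: w i by rewrite -BE mulmxKV.
rewrite derive_linear_comb// dot_suml big1// => i _.
by rewrite dotZl dotC Nw mulr0.
Qed.

Lemma orthonormal_frame :
  exists (D : set V) (w : 'I_n -> V -> V) (N : V -> W),
  [/\ open D, D `<=` U, D x0, (forall i, smooth_on D (w i)) /\ smooth_on D N &
    [/\ forall x, D x -> forall i j,
          dot ('D_(w i x) F x) ('D_(w j x) F x) = (i == j)%:R,
        forall x, D x -> dot (N x) (N x) = 1 &
        forall x, D x -> forall v, dot ('D_v F x) (N x) = 0]].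
Proof.
have [D [w [oD DU Dx0 sw ww]]] := orthonormal_fields (leqnn n).
pose T i x : W := 'D_(w i x) F x.
(* A constant vector normal to the hypersurface at [x0]; [gram_schmidt_step] corrects it to a unit
   normal field nearby. *)
have [N0 N00 NT] := nontrivial_solution (fun b (i : 'I_n) => T i x0 0 b) (leqnn n.+1).
have sT i b : smooth D (fun x => T i x 0 b).
  by apply: derive_field_smooth => // j; exact: sw.
have TT x : D x -> forall i j : 'I_n, predT i -> predT j ->
    dot (T i x) (T j x) = (i == j)%:R.
  by move=> Dx i j _ _; exact: ww.
have [D' [s [oD' D'D D'x0 ss gs]]] :=
  gram_schmidt_step (G := fun=> N0) oD Dx0 (fun i b (_ : predT i) => sT i b) TT
    (fun b => smooth_cst D (N0 0 b)) N00 (fun i _ => NT i).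
exists D', w, (fun x => s x *: orth_part predT (T^~ x) N0); split=> //.
- exact: subset_trans D'D DU.
- split=> [i|]; apply: smooth_on_coords => // j.
    by apply: smooth_sub D'D _; exact: sw.
  have : smooth D' (fun x => s x * (N0 0 j - \sum_i dot N0 (T i x) * T i x 0 j)).
    apply: smoothM => //; apply: smoothB => //; first exact: smooth_cst.
    apply: smooth_sum => // i _; have sT' b := smooth_sub D'D (sT i b).
    by apply: smoothM => //; apply: smooth_dot => // b; exact: smooth_cst.
  apply: smooth_ext => // x _; rewrite !mxE summxE; congr (_ * (_ - _)).
  by apply: eq_bigr => l _; rewrite mxE.
- split=> [x /D'D Dx i j|x D'x|x D'x v].
  + exact: ww.
  + by case: (gs x D'x).
  + case: (gs x D'x) => _ gT; apply: (tangent_orth (DU _ (D'D _ D'x))) => [i j|i].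
      by apply: ww => //; exact: D'D.
    exact: gT.
Qed.

End FrameExistence.

Lemma adapted_frame_exists (R : realType) (n : nat) (M : smooth_manifold R n)
    (X : M -> 'rV[R]_n.+1) (p : M) : immersion X ->
  exists e : adapted_frame X, frame_at e p.
Proof.
move=> X_imm; have [c ac cp] := atlas_cover p.
have [sX Xi] := X_imm c ac.
have ip : img c (fwd c p) by exists p.
have [D [w [N [oD DU Dp [sw sN] [ww NN wN]]]]] :=
  orthonormal_frame (@img_open _ _ _ c) ip sX Xi.
by exists (@AdaptedFrame R n M X c D w N ac oD DU sw sN ww NN wN).
Qed.

Theorem theorem1p3 (R : realType) (n : nat) (M : smooth_manifold R n)
    (X : M -> 'rV[R]_n.+1) (r : R)
    (M_nonempty : [set: M] !=set0) (M_connected : connected [set: M])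
    (X_shrinker : self_shrinker X)
    (r_gt0 : 0 < r)
    (scal_const : forall (p : M) (e : adapted_frame X),
       frame_at e p -> scalar_curvature e p = r) :
  0 < r <= n%:R - 1 /\
  (forall (p : M) (e : adapted_frame X), frame_at e p -> sff_normsq e p <= 1).
Proof.
split; last exact: sff_normsq_le1 X_shrinker r_gt0 scal_const.
(* The bound on [r] mentions neither point nor frame, so a point is taken and a frame is built
   there. *)
have [p _] := M_nonempty; have [X_imm _] := X_shrinker.
have [e ep] := adapted_frame_exists p X_imm.
by rewrite r_gt0 (scalar_curvature_le X_shrinker r_gt0 scal_const ep).
Qed.
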